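(* Let $K$ be a local field of characteristic $0$ with ring of integers $\mathcal{O}$, uniformiser $\pi$, normalised valuation $v$ and residue field $k=\mathcal{O}/\pi$ of cardinality $q$, and let $n$ be a positive integer dividing $q-1$. Let $$1\rightarrow\bm{\mu}_{n}\rightarrow\tilde{K}^{\times}\rightarrow K^{\times}\rightarrow 1$$ be the central extension described in the context below, and for $a,b\in K^\times$ let $\{a,b\}=\tilde a\tilde b\tilde a^{-1}\tilde b^{-1}\in\bm{\mu}_n$, where $\tilde a,\tilde b\in\tilde K^\times$ are arbitrary lifts of $a,b$. Then for every $a,b\in K^{\times}$, $$\{a,\ b\}=\left(\frac{a^{v(b)}}{b^{v(a)}}\pmod \pi\right)^{\frac{q-1}{n}},$$ where $\bm{\mu}_n\subset K^\times$ is identified with the group of $n$-th roots of unity of $k$ via reduction modulo $\pi$.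
   Context: $\bm{\mu}_n\subset \mathcal{O}^\times$ denotes the group of $n$-th roots of unity in $K$. A finite free pointed $\bm{\mu}_n$-set is a finite pointed set $(X,* )$ with a $\bm{\mu}_n$-action fixing $*$ and free on $\tilde X=X\smallsetminus\{*\}$; morphisms are $\bm{\mu}_n$-equivariant pointed bijections. Every finite $\mathcal{O}$-module is such a set via $\bm{\mu}_n\subset\mathcal{O}$, with marked point $0$. A $\bm{\mu}_n$-line is a set with a free transitive $\bm{\mu}_n$-action; the tensor product $L\otimes M$ of two lines is the quotient of $L\times M$ by $(\mu l,m)\sim(l,\mu m)$, with $\mu\cdot(l,m)=(\mu l,m)$; for pointed sets $X,Y$ with $\tilde X,\tilde Y$ lines, $X\otimes Y=\{*\}\sqcup(\tilde X\otimes\tilde Y)$. Write $\bm{\mu}_n^*=\{*\}\sqcup\bm{\mu}_n$. The determinant of a finite free pointed $\bm{\mu}_n$-set $X$ whose $\bm{\mu}_n$-orbits in $\tilde X$ are $L_1,\dots,L_t$ is $\det(X)=\{*\}\sqcup(L_1\otimes\cdots\otimes L_t)$ (the empty tensor product being $\bm{\mu}_n$); an automorphism $f$ of $X$ induces an automorphism of $\det(X)$, which is multiplication by an element $\det(f)\in\bm{\mu}_n$. The dual of $X$ with $\tilde X$ a line is $X^\vee=\{*\}\sqcup\mathrm{Hom}_{\bm{\mu}_n}(\tilde X,\bm{\mu}_n)$, and evaluation gives a canonical isomorphism $X\otimes X^\vee\simeq\bm{\mu}_n^*$. For an exact sequence $0\to X\to Y\to Z\to 0$ of finite $\mathcal{O}$-modules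 there is a canonical isomorphism $\det(X)\otimes\det(Z)\simeq\det(Y)$, obtained as follows: identifying all elements of $X$ with $0$ gives a pointed $\bm{\mu}_n$-set $Y/\!/X$ with $\det(Y)=\det(X)\otimes\det(Y/\!/X)$ (orbits of $Y$ split into orbits of $X$ and of $Y/\!/X$); the induced map $Y/\!/X\to Z$ has fibres over nonzero points of cardinality $|X|\equiv 1\pmod n$, so each orbit $L\subset\tilde Z$ has preimage a disjoint union of orbits $M_1,\dots,M_r$ with $r\equiv1\pmod n$, and $l\mapsto(f_1^{-1}(l),\dots,f_r^{-1}(l))$ induces $L\simeq M_1\otimes\cdots\otimes M_r$, whence $\det(Z)\simeq\det(Y/\!/X)$. For $\mathcal{O}$-submodules $A,B\subset K$ with $A/A\cap B$ and $B/A\cap B$ finite, set $(A\mid B)=\det(A/A\cap B)\otimes\det(B/A\cap B)^\vee$. Canonically $(A\mid A)=\bm{\mu}_n^*$, $(A\mid B)=\det(A/B)$ if $B\subset A$, $(A\mid B)=\det(B/A)^\vee$ if $A\subset B$, $(B\mid A)=(A\mid B)^\vee$, $(A\mid B)=(A\mid A\cap B)\otimes(A\cap B\mid B)$. For $f\in K^\times$, $\rho_f:(A\mid B)\to(fA\mid fB)$ is the tensor product of the map on $\det(A/A\cap B)$ induced by $f$ and the dual of the map on determinants induced by $f^{-1}:fB/(fA\cap fB)\to B/A\cap B$. The contraction isomorphism $\kappa:(A\mid B)\otimes(B\mid C)\to(A\mid C)$ is: the duality pairing if $A=C$; the exact-sequence isomorphism $\det(A/B)\otimes\det(B/C)\simeq\det(A/C)$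 if $A\supset B\supset C$; the inverse of the dual of $\det(B/A)\otimes\det(C/B)\simeq\det(C/A)$ if $A\subset B\subset C$; in general, with $D=A\cap B\cap C$, the composite $(A\mid B)\otimes(B\mid C)=(A\mid A\cap B)\otimes(A\cap B\mid B)\otimes(B\mid B\cap C)\otimes(B\cap C\mid C)\simeq(A\mid A\cap B)\otimes(A\cap B\mid D)\otimes(D\mid A\cap B)\otimes(A\cap B\mid B)\otimes(B\mid B\cap C)\otimes(B\cap C\mid D)\otimes(D\mid B\cap C)\otimes(B\cap C\mid C)\simeq(A\mid D)\otimes(D\mid B)\otimes(B\mid D)\otimes(D\mid C)\simeq(A\mid D)\otimes(D\mid C)\simeq(A\mid A\cap C)\otimes(A\cap C\mid D)\otimes(D\mid A\cap C)\otimes(A\cap C\mid C)\simeq(A\mid A\cap C)\otimes(A\cap C\mid C)=(A\mid C)$, using the previous cases. The group $\tilde K^\times$ is the set of pairs $(f,s)$ with $f\in K^\times$, $s\in(\mathcal{O}\mid f\mathcal{O})\smallsetminus\{*\}$, with product $(f,s)(g,t)=(fg,\kappa(s\otimes\rho_f(t)))$ where $\kappa:(\mathcal{O}\mid f\mathcal{O})\otimes(f\mathcal{O}\mid fg\mathcal{O})\to(\mathcal{O}\mid fg\mathcal{O})$; the maps are $\mu\mapsto(1,\mu)$ and $(f,s)\mapsto f$. *)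

(* Defs.v *)
(* MathComp, with the classical sets of MathComp-Analysis. *)
From mathcomp Require Import all_boot all_order all_algebra.
From mathcomp Require Import boolp classical_sets functions cardinality fsbigop.

Set Implicit Arguments.
Unset Strict Implicit.
Unset Printing Implicit Defensive.
Import Order.TTheory GRing.Theory Num.Theory.
Local Open Scope classical_set_scope.
Local Open Scope ring_scope.

(* ---- Local fields ------------------------------------------------------ *)

Section LocalField.
Variables (K : fieldType) (v : K -> int).

(* The valuation is integer-valued; v 0, which should be +oo, is never used. *)
Definition val_ge (N : int) : set K := [set x | x = 0 \/ N <= v x].

Definition val_ring : set K := val_ge 0.

Record normalised_valuation : Prop := NormalisedValuation {
  valuationM : forall x y, x != 0 -> y != 0 -> v (x * y) = v x + v y;
  valuationD : forall x y, x != 0 -> y != 0 -> x + y != 0 ->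
    Num.min (v x) (v y) <= v (x + y);
  valuation_surj : forall N : int, exists2 x, x != 0 & v x = N }.

Definition val_cauchy (u : nat -> K) : Prop :=
  forall N : int, exists M : nat, forall i j : nat,
    (M <= i)%N -> (M <= j)%N -> val_ge N (u i - u j).

Definition val_converges (u : nat -> K) (l : K) : Prop :=
  forall N : int, exists M : nat, forall i : nat,
    (M <= i)%N -> val_ge N (u i - l).

Definition val_complete : Prop :=
  forall u : nat -> K, val_cauchy u -> exists l, val_converges u l.

Definition uniformiser (pi : K) : Prop := pi != 0 /\ v pi = 1.

(* [red], restricted to the valuation ring O, is a surjective ring morphism
   to k with kernel pi O, i.e. it identifies O / pi O with k; its values
   outside O are irrelevant. *)
Record residue_map (pi : K) (k : nzRingType) (red : K -> k) : Prop :=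
  ResidueMap {
    residue1 : red 1 = 1;
    residueD : forall x y, val_ring x -> val_ring y ->
      red (x + y) = red x + red y;
    residueM : forall x y, val_ring x -> val_ring y ->
      red (x * y) = red x * red y;
    residue_surj : forall c : k, exists2 x, val_ring x & red x = c;
    residue_ker : forall x, val_ring x ->
      (red x = 0 <-> exists2 y, val_ring y & x = pi * y) }.

(* A local field of characteristic 0 (with a ring of integers): complete for
   a normalised discrete valuation, with a finite residue field. *)
Record local_field0 (pi : K) (k : finFieldType) (red : K -> k) : Prop :=
  LocalField0 {
    local_pchar0 : [pchar K] =i pred0;
    local_valuation : normalised_valuation;
    local_complete : val_complete;
    local_uniformiser : uniformiser pi;
    local_residue : residue_map pi red }.

End LocalField.

(* ---- Sets with an action of the n-th roots of unity -------------------- *)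

(* A mu_n-set is a subset [pts] of an ambient type [amb] on which the scalars
   act (only the action of mu_n matters).  Working inside ambient types that do
   not depend on the submodules involved turns the canonical equalities of the
   theory, such as A/(A n B) = A/B for B in A or f(gO) = (fg)O, into plain
   equalities of sets.

   The marked point of a pointed set X whose complement X~ is a mu_n-line is
   an isolated extra point that carries no information; for such X, only the
   line X~ is represented, so that {*} U mu_n becomes mu_n, X (x) Y becomes
   X~ (x) Y~, and the elements below are always non-marked ones. *)

(* From here on every argument is explicit. *)
Unset Implicit Arguments.

Section RootsOfUnity.
Variables (K : fieldType) (n : nat).

Definition mu : set K := [set z | z ^+ n = 1].

Record muSet := MuSet {
  amb : choiceType;
  act : K -> amb -> amb;
  pts : set amb }.

Record pmuSet := PMuSet {
  underlying :> muSet;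
  mark : amb underlying }.

Definition nonmarked (X : pmuSet) : set (amb X) :=
  [set x | pts X x /\ x <> mark X].

(* Tensor product of lines: l (x) m is the class of all pairs (z^-1 l, z m). *)

Definition tens (L M : muSet) (l : amb L) (m : amb M) : set (amb L * amb M) :=
  [set p | exists z, [/\ mu z, l = act L z p.1 & p.2 = act M z m]].

Definition tensor (L M : muSet) : muSet := {|
  amb := set (amb L * amb M);
  act := fun z s => [set (act L z p.1, p.2) | p in s];
  pts := [set s | exists l m, [/\ pts L l, pts M m & s = tens L M l m]] |}.

(* Functions on classes are defined as the union of the classes of the images
   of all representatives; this union is a single class exactly when the
   function is well defined. *)
Definition tensor_map (L M L' M' : muSet) (g : amb L -> amb L')
    (h : amb M -> amb M') (s : amb (tensor L M)) : amb (tensor L' M') :=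
  \bigcup_(p in s) tens L' M' (g p.1) (h p.2).

(* Dual of a line: Hom_mu(L, mu), a homomorphism being extended by 0 outside
   L. *)
Definition dual (L : muSet) : muSet := {|
  amb := (amb L -> K);
  act := fun z phi l => z * phi l;
  pts := [set phi | [/\ forall l, pts L l -> mu (phi l),
    forall l, ~ pts L l -> phi l = 0 &
    forall z l, mu z -> pts L l -> phi (act L z l) = z * phi l]] |}.

Definition dual_map (L M : muSet) (h : amb L -> amb M) (phi : amb (dual M)) :
    amb (dual L) :=
  fun l => if `[< pts L l >] then phi (h l) else 0.

(* ---- Determinants ------------------------------------------------------ *)

(* A point of L_1 x ... x L_t, the L_i being the orbits of X~, is a set S of
   representatives of these orbits. *)
Definition transversal (X : pmuSet) (S : set (amb X)) : Prop :=
  S `<=` nonmarked X /\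
  forall x, nonmarked X x ->
    exists! s, S s /\ exists2 z, mu z & x = act X z s.

(* An element of mu (x) L_1 (x) ... (x) L_t is written zeta (x) S; the factor mu
   makes the empty tensor product equal to mu.  Replacing each s in S by
   r(s) s multiplies the tensor by the product of all the r(s). *)
Definition det_class (X : pmuSet) (zeta : K) (S : set (amb X)) :
    set (K * set (amb X)) :=
  [set p | exists r : amb X -> K,
    [/\ forall s, S s -> mu (r s),
        p.2 = [set act X (r s) s | s in S] &
        zeta = p.1 * \big[*%R/1]_(s \in S) r s]].

Definition det (X : pmuSet) : muSet := {|
  amb := set (K * set (amb X));
  act := fun z d => [set (z * p.1, p.2) | p in d];
  pts := [set d | exists zeta S,
    [/\ mu zeta, transversal X S & d = det_class X zeta S]] |}.

Definition det_map (X Y : pmuSet) (f : amb X -> amb Y) (d : amb (det X)) :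
    amb (det Y) :=
  \bigcup_(p in d) det_class Y p.1 (f @` p.2).

(* det X (x) det Z -> det Y for an exact sequence X -i-> Y -p-> Z, as a
   bi-equivariant function of two arguments: representatives of the orbits of
   X~ and of Z~ give the representatives i(S) U p^-1(S') of the orbits
   of Y~. *)
Definition det_exact (X Y Z : pmuSet) (i : amb X -> amb Y) (p : amb Y -> amb Z)
    (d : amb (det X)) (e : amb (det Z)) : amb (det Y) :=
  \bigcup_(a in d) \bigcup_(b in e)
    det_class Y (a.1 * b.1) ((i @` a.2) `|` (pts Y `&` p @^-1` b.2)).

(* ---- Relative determinants of submodules of K -------------------------- *)

Definition scale (f : K) (A : set K) : set K := [set f * x | x in A].

Definition addset (A B : set K) : set K := [set x + y | x in A & y in B].

(* The quotient A/B, with the cosets x + B as points and B as marked point. *)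
Definition quot (A B : set K) : pmuSet := {|
  underlying := {| amb := set K; act := scale;
                   pts := [set addset [set x] B | x in A] |};
  mark := B |}.

(* det (B/C) (x) det (A/B) -> det (A/C) for C in B in A: the inclusion
   B/C -> A/C does not change cosets, and A/C -> A/B is E |-> E + B. *)
Definition det_chain (A B C : set K) (d : amb (det (quot B C)))
    (e : amb (det (quot A B))) : amb (det (quot A C)) :=
  det_exact (quot B C) (quot A C) (quot A B) id (addset ^~ B) d e.

(* (A | B).  All definitions are total; they have their intended meaning for
   O-submodules A, B of K such that A / A n B and B / A n B are finite, in which
   case these quotients are finite free pointed mu_n-sets. *)
Definition rel (A B : set K) : muSet :=
  tensor (det (quot A (A `&` B))) (dual (det (quot B (A `&` B)))).

Definition rho (f : K) (A B : set K) (s : amb (rel A B)) :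
    amb (rel (scale f A) (scale f B)) :=
  let fA := scale f A in let fB := scale f B in
  tensor_map (det (quot A (A `&` B))) (dual (det (quot B (A `&` B))))
    (det (quot fA (fA `&` fB))) (dual (det (quot fB (fA `&` fB))))
    (det_map (quot A (A `&` B)) (quot fA (fA `&` fB)) (scale f))
    (dual_map (det (quot fB (fA `&` fB))) (det (quot B (A `&` B)))
      (det_map (quot fB (fA `&` fB)) (quot B (A `&` B)) (scale f^-1)))
    s.

(* The point zeta of det (A/A) = mu, and the point 1 of its dual. *)
Definition det_scalar (A : set K) (zeta : K) : amb (det (quot A A)) :=
  det_class (quot A A) zeta set0.

Definition dual_one (A : set K) : amb (dual (det (quot A A))) :=
  fun d => xget 0 [set z | mu z /\ d = det_scalar A z].

(* (A | B) = det (A/B) if B is contained in A, in both directions. *)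
Definition of_det (A B : set K) (d : amb (det (quot A B))) : amb (rel A B) :=
  tens (det (quot A B)) (dual (det (quot B B))) d (dual_one B).

Definition to_det (A B : set K) (s : amb (rel A B)) : amb (det (quot A B)) :=
  xget set0 [set d | pts (det (quot A B)) d /\ s = of_det A B d].

(* (A | B) = det (B/A)^v if A is contained in B, in both directions. *)
Definition of_dual (A B : set K) (phi : amb (dual (det (quot B A)))) :
    amb (rel A B) :=
  tens (det (quot A A)) (dual (det (quot B A))) (det_scalar A 1) phi.

Definition to_dual (A B : set K) (s : amb (rel A B)) :
    amb (dual (det (quot B A))) :=
  xget (fun=> 0)
    [set phi | pts (dual (det (quot B A))) phi /\ s = of_dual A B phi].

(* ---- The contraction isomorphism --------------------------------------- *)
(* kappa and its special cases, again as bi-equivariant functions of two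
   arguments. *)

(* C = A: the duality pairing (A | B) (x) (B | A) -> mu. *)
Definition kappa_pair (A B : set K) (s : amb (rel A B)) (t : amb (rel B A)) :
    K :=
  xget 0 [set z | exists a phi b psi,
    [/\ s (a, phi), t (b, psi) & z = phi b * psi a]].

(* A contains B and B contains C. *)
Definition kappa_down (A B C : set K) (s : amb (rel A B)) (t : amb (rel B C)) :
    amb (rel A C) :=
  of_det A C (det_chain A B C (to_det B C t) (to_det A B s)).

(* A is contained in B and B in C: the inverse of the dual of
   det (B/A) (x) det (C/B) = det (C/A). *)
Definition kappa_up (A B C : set K) (s : amb (rel A B)) (t : amb (rel B C)) :
    amb (rel A C) :=
  of_dual A C (fun w => xget 0 [set z | exists b c,
    [/\ pts (det (quot B A)) b, pts (det (quot C B)) c,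
        w = det_chain C B A b c & z = to_dual A B s b * to_dual B C t c]]).

(* For D contained in A n B, the isomorphism (A | B) = (A | D) (x) (D | B)
   obtained from
     (A | B) = (A | AB) (x) (AB | B)
             = (A | AB) (x) (AB | D) (x) (D | AB) (x) (AB | B)
             = (A | D) (x) (D | B),
   where AB = A n B; u (x) u' runs over the preimages of 1 under the duality
   pairing. *)
Definition kappa_split (D A B : set K) (s : amb (rel A B)) :
    amb (tensor (rel A D) (rel D B)) :=
  let AB := A `&` B in
  [set p | exists a phi u u',
    [/\ s (a, phi),
        pts (rel AB D) u, pts (rel D AB) u', kappa_pair AB D u u' = 1 &
        tens (rel A D) (rel D B)
          (kappa_down A AB D (of_det A AB a) u)
          (kappa_up D AB B u' (of_dual AB B phi)) p]].

(* (A | D) (x) (D | B) (x) (B | D) (x) (D | C) -> (A | D) (x) (D | C). *)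
Definition kappa_contract (D A B C : set K)
    (s : amb (tensor (rel A D) (rel D B)))
    (t : amb (tensor (rel B D) (rel D C))) :
    amb (tensor (rel A D) (rel D C)) :=
  \bigcup_(x in s) \bigcup_(y in t)
    tens (rel A D) (rel D C)
      (act (rel A D) (kappa_pair D B x.2 y.1) x.1) y.2.

(* The general case, which agrees with the special ones above; the last
   isomorphism of the composite is the inverse of [kappa_split D A C]. *)
Definition kappa (A B C : set K) (s : amb (rel A B)) (t : amb (rel B C)) :
    amb (rel A C) :=
  let D := A `&` B `&` C in
  xget set0 [set w | pts (rel A C) w /\
    kappa_split D A C w =
      kappa_contract D A B C (kappa_split D A B s) (kappa_split D B C t)].

(* ---- The central extension --------------------------------------------- *)

Variable O : set K.

(* The type of the points of (O | fO); it does not depend on f. *)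
Definition relT : choiceType := amb (rel O O).

Definition ext : set (K * relT) :=
  [set x | x.1 != 0 /\ pts (rel O (scale x.1 O)) x.2].

Definition ext_mul (x y : K * relT) : K * relT :=
  (x.1 * y.1,
   kappa O (scale x.1 O) (scale (x.1 * y.1) O) x.2
     (rho x.1 O (scale y.1 O) y.2)).

(* mu -> ext, zeta |-> (1, zeta), through (O | O) = mu. *)
Definition ext_mu (zeta : K) : K * relT :=
  (1, of_det O O (det_scalar O zeta)).

Definition ext_one : K * relT := ext_mu 1.

(* The inverse in the group of pairs; the default value of [xget] is not meant
   to be used. *)
Definition ext_inv (x : K * relT) : K * relT :=
  xget x [set y | [/\ ext y, ext_mul x y = ext_one & ext_mul y x = ext_one]].

Definition ext_comm (x y : K * relT) : K * relT :=
  ext_mul (ext_mul (ext_mul x y) (ext_inv x)) (ext_inv y).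

End RootsOfUnity.

(* Main.v *)
Require Import Defs.
From mathcomp Require Import all_boot all_order all_algebra all_field.
From mathcomp Require Import zify ring.
From mathcomp Require Import boolp classical_sets functions cardinality fsbigop.

(* All submodules of K that occur are powers P i of the maximal ideal.  Choose
   a mu_n-equivariant map theta : K^* -> mu_n that depends only on the leading
   term.  It induces an equivariant map on the nonzero elements of P i / P j,
   hence a trivialisation of det (P i / P j): the tensor zeta (x) S goes to
   zeta times the product of theta over S.  These trivialisations are
   compatible with exact sequences, because the fibres of P i / P l -> P i / P j
   have #|k|^(l - j) elements and #|k| = 1 modulo n; so after identifying every
   (P i | P j) with mu_n the contraction isomorphism is the multiplication.
   Multiplication by f acts on det (P i / P (i + 1)) by the element chi f of
   mu_n that lifts the ((q - 1) / n)-th power of the leading coefficient of f,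
   hence on (P i | P j) by chi f ^ (j - i).  The extension becomes K^* x mu_n
   with (f, c) (g, d) = (f g, c d chi f ^ v g), and the commutator of lifts of a
   and b is chi a ^ v b / chi b ^ v a. *)

Set Implicit Arguments.
Unset Strict Implicit.
Unset Printing Implicit Defensive.
Import Order.TTheory GRing.Theory Num.Theory.
Local Open Scope classical_set_scope.
Local Open Scope ring_scope.

(** * Roots of unity in a field *)

Section RootsOfUnity.
Context {K : fieldType} {n : nat} (n_gt0 : (0 < n)%N).
Local Notation mu := (mu K n).

Lemma mu1 : mu 1. Proof. exact: expr1n. Qed.

Lemma muM x y : mu x -> mu y -> mu (x * y).
Proof. by rewrite /Defs.mu /= exprMn => -> ->; rewrite mulr1. Qed.

Lemma muV x : mu x -> mu x^-1.
Proof. by rewrite /Defs.mu /= exprVn => ->; rewrite invr1. Qed.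

Lemma mu_neq0 x : mu x -> x != 0.
Proof.
by rewrite /Defs.mu /= => /eqP; apply: contraTneq => ->; rewrite expr0n gtn_eqF // eq_sym oner_eq0.
Qed.

Lemma mu_fsprod (I : choiceType) (S : set I) (f : I -> K) :
  (forall i, S i -> mu (f i)) -> mu (\big[*%R/1]_(i \in S) f i).
Proof.
move=> muf; rewrite big_seq; apply: (big_ind mu); [exact: mu1|exact: muM|].
by move=> i; case: finite_supportP => // X XS _ _ /XS; exact: muf.
Qed.

End RootsOfUnity.

(** * Trivialised lines *)

Section Lines.
Context {K : fieldType} {n : nat} (n_gt0 : (0 < n)%N).
Local Notation mu := (mu K n).
Implicit Types (L M : muSet K).

(** [e] is a coordinate system on the line, of which only the values on mu matter. It goes from
    coordinates to points because points of tensor products and determinants are classes, and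
    identities between classes then become identities between coordinates. *)
Record trivialisation (L : muSet K) (e : K -> amb K L) : Prop := Trivialisation {
  triv_act1 : forall l, act K L 1 l = l;
  triv_actM : forall z w l, mu z -> mu w ->
    act K L z (act K L w l) = act K L (z * w) l;
  triv_act : forall z c, mu z -> mu c -> act K L z (e c) = e (z * c);
  triv_pts : forall l, pts K L l <-> exists2 c, mu c & l = e c;
  triv_inj : forall c d, mu c -> mu d -> e c = e d -> c = d }.
Arguments trivialisation : clear implicits.

(** The point of the tensor product with coordinate c: the class of all pairs whose coordinates
    multiply to c. *)
Definition pair_fiber {A B : Type} (e : K -> A) (f : K -> B) (c : K) : set (A * B) :=
  [set p | exists c1 c2, [/\ mu c1, mu c2, p = (e c1, f c2) & c1 * c2 = c]].

(** In coordinates this is multiplication by c; the default 0 of [xget] produces the value 0 that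
    [dual] prescribes off the line. *)
Definition dual_triv {A : Type} (e : K -> A) (c : K) (l : A) : K :=
  c * xget 0 [set d | mu d /\ l = e d].

Section Theory.
Context {L M : muSet K} {e : K -> amb K L} {f : K -> amb K M}.
Hypotheses (eL : trivialisation L e) (fM : trivialisation M f).

Lemma triv_mem c : mu c -> pts K L (e c).
Proof. by move=> muc; apply/(triv_pts eL); exists c. Qed.

Lemma triv_actK z l : mu z -> act K L z^-1 (act K L z l) = l.
Proof.
move=> muz; rewrite (triv_actM eL) //; last exact: muV.
by rewrite mulVf ?(triv_act1 eL) // (mu_neq0 n_gt0).
Qed.

(** The pairs (z^-1 l, z m) and (l, m) have the same product of coordinates; conversely, two pairs
    with the same product differ by the root of unity c / c1. *)
Lemma tens_triv c d : mu c -> mu d -> tens K n L M (e c) (f d) = pair_fiber e f (c * d).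
Proof.
move=> muc mud; apply/seteqP; split=> -[l m] /=.
  case=> z [muz /= el em].
  have zN : z != 0 by exact: mu_neq0 muz.
  exists (z^-1 * c), (z * d); split; [exact: muM (muV muz) _|exact: muM| |].
    congr pair; last by rewrite em (triv_act fM).
    by rewrite -(triv_act eL) // ?el ?triv_actK //; exact: muV.
  by rewrite mulrACA mulVf // mul1r.
move=> [c1 [c2 [muc1 muc2 [-> ->] cE]]].
have c1N := mu_neq0 n_gt0 muc1.
have muz : mu (c / c1) by exact: muM (muV _).
exists (c / c1); split => //=; first by rewrite (triv_act eL) // divfK.
rewrite (triv_act fM) //; congr f; apply: (mulfI c1N); rewrite cE.
by rewrite mulrCA mulrA divfK.
Qed.

Lemma pair_fiber_inj c d : mu c -> mu d -> pair_fiber e f c = pair_fiber e f d -> c = d.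
Proof.
move=> muc mud cd.
have : pair_fiber e f c (e c, f 1).
  by exists c, 1; split; rewrite ?mulr1 //; exact: mu1.
rewrite cd => -[c1 [c2 [muc1 muc2 [ec f1] <-]]].
have <- := triv_inj eL muc muc1 ec.
by have <- := triv_inj fM mu1 muc2 f1; rewrite mulr1.
Qed.

Lemma triv_tensor : trivialisation (tensor K n L M) (pair_fiber e f).
Proof.
split.
- move=> s; apply/seteqP; split=> [_ [[l m] sp <-] /=|[l m] sp].
    by rewrite (triv_act1 eL).
  by exists (l, m); rewrite //= (triv_act1 eL).
- move=> z w s muz muw; apply/seteqP; split=> [_ [_ [[l m] sp <-] <-] /=|_ [[l m] sp <-]] /=.
    by exists (l, m) => //=; rewrite (triv_actM eL).
  by exists (act K L w l, m); [exists (l, m)|rewrite /= (triv_actM eL)].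
- move=> z c muz muc; have zN := mu_neq0 n_gt0 muz.
  apply/seteqP; split=> [_ [_ [c1 [c2 [muc1 muc2 -> <-]] <-]] /=|].
    exists (z * c1), c2; rewrite (triv_act eL) // mulrA; split=> //; exact: muM.
  move=> _ [c1 [c2 [muc1 muc2 -> c12]]]; exists (e (z^-1 * c1), f c2) => /=; last first.
    by rewrite (triv_act eL) ?mulVKf //; exact: muM (muV muz) _.
  exists (z^-1 * c1), c2; rewrite -mulrA c12 mulKf //; split=> //.
  exact: muM (muV muz) _.
- move=> s; split=> [[l [m [/(triv_pts eL)[c muc ->] /(triv_pts fM)[d mud ->] ->]]]|[c muc ->]].
    by exists (c * d); [exact: muM|exact: tens_triv].
  exists (e c), (f 1); rewrite tens_triv ?mulr1 //; last exact: mu1.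
  by split=> //; [exact: triv_mem|apply/(triv_pts fM); exists 1 => //; exact: mu1].
- exact: pair_fiber_inj.
Qed.

Lemma dual_trivE c d : mu d -> dual_triv e c (e d) = c * d.
Proof.
move=> mud; congr *%R; apply: xget_unique => // d' [mud' /(triv_inj eL) <- //].
Qed.

Lemma dual_triv0 c l : ~ pts K L l -> dual_triv e c l = 0.
Proof.
move=> Ll; rewrite /dual_triv xgetPN ?mulr0 // => d [mud lE].
by apply: Ll; rewrite lE; exact: triv_mem.
Qed.

Lemma triv_dual : trivialisation (dual K n L) (dual_triv e).
Proof.
split.
- by move=> phi; apply/funext => l /=; rewrite mul1r.
- by move=> z w phi _ _; apply/funext => l /=; rewrite mulrA.
- by move=> z c _ _; apply/funext => l /=; rewrite /dual_triv mulrA.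
- move=> phi; split=> [[phimu phi0 phiact]|[c muc ->]].
    exists (phi (e 1)); first by apply: phimu; apply: triv_mem; exact: mu1.
    apply/funext => l; case: (pselect (pts K L l)) => [|Ll]; last first.
      by rewrite phi0 // dual_triv0.
    move=> /(triv_pts eL)[d mud ->]; rewrite dual_trivE //.
    rewrite -{1}[d]mulr1 -(triv_act eL) //; last exact: mu1.
    by rewrite phiact //; [rewrite mulrC|apply: triv_mem; exact: mu1].
  split=> [l /(triv_pts eL)[d mud ->]|l /dual_triv0 //|z l muz /(triv_pts eL)[d mud ->]].
    by rewrite dual_trivE //; exact: muM.
  by rewrite (triv_act eL) // !dual_trivE //; [rewrite mulrCA|exact: muM].
- move=> c d muc mud cd; have := congr1 (@^~ (e 1)) cd.
  by rewrite /= !dual_trivE ?mulr1 //; exact: mu1.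
Qed.

End Theory.

(** When g and h act on coordinates by s and t, all representatives of a class are sent into one
    class, so the union defining [tensor_map] is that class. *)
Lemma tensor_map_triv (L M L' M' : muSet K) e f e' f' g h s t :
  trivialisation L e -> trivialisation M f ->
  trivialisation L' e' -> trivialisation M' f' -> mu s -> mu t ->
  (forall c, mu c -> g (e c) = e' (s * c)) ->
  (forall c, mu c -> h (f c) = f' (t * c)) ->
  forall c, mu c -> tensor_map K n L M L' M' g h (pair_fiber e f c) =
    pair_fiber e' f' (s * t * c).
Proof.
move=> eL fM eL' fM' mus mut gE hE c muc.
have step c1 c2 : mu c1 -> mu c2 -> c1 * c2 = c ->
    tens K n L' M' (g (e c1)) (h (f c2)) = pair_fiber e' f' (s * t * c).
  move=> muc1 muc2 <-; rewrite gE // hE // (tens_triv eL' fM'); try exact: muM.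
  by rewrite mulrACA.
apply/seteqP; split=> [p [_ [c1 [c2 [muc1 muc2 -> c12]]] /=]|p pE]; first by rewrite step.
exists (e c, f 1); first by exists c, 1; rewrite mulr1; split=> //; exact: mu1.
by rewrite /= step ?mulr1 //; exact: mu1.
Qed.

(** Transposition reverses the arrow but keeps the scalar s. *)
Lemma dual_map_triv (L M : muSet K) e f h s :
  trivialisation L e -> trivialisation M f -> mu s ->
  (forall c, mu c -> h (e c) = f (s * c)) ->
  forall c, mu c -> dual_map K n L M h (dual_triv f c) = dual_triv e (s * c).
Proof.
move=> eL fM mus hE c muc; apply/funext => l; rewrite /dual_map.
case: asboolP => [/(triv_pts eL)[d mud ->]|Ll]; last by rewrite (dual_triv0 eL).
by rewrite hE // (dual_trivE fM) ?(dual_trivE eL) //; [rewrite mulrCA mulrA|exact: muM].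
Qed.

End Lines.

(** * Determinants of free pointed mu_n-sets *)

Section Determinants.
Context {K : fieldType} {n : nat} (n_gt0 : (0 < n)%N).
Local Notation mu := (mu K n).
Implicit Types X Y Z : pmuSet K.

(* An equivariant map to mu on the free pointed mu_n-set [X] trivialises
   [det X], by zeta (x) S |-> zeta times the product of its values on S. *)
Record frame X (theta : amb K X -> K) : Prop := Frame {
  frame_finite : finite_set (nonmarked K X);
  frame_act1 : forall x, act K X 1 x = x;
  frame_actM : forall z w x, mu z -> mu w ->
    act K X z (act K X w x) = act K X (z * w) x;
  frame_nonmarked : forall z x, mu z -> nonmarked K X x ->
    nonmarked K X (act K X z x);
  frame_mu : forall x, nonmarked K X x -> mu (theta x);
  frame_act : forall z x, mu z -> nonmarked K X x ->
    theta (act K X z x) = z * theta x }.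

(** As with [pair_fiber], a point of [det X] is recovered as the whole class of its representatives
    from the value that they share. *)
Definition det_triv X (theta : amb K X -> K) (c : K) : set (K * set (amb K X)) :=
  [set p | [/\ mu p.1, Defs.transversal K n X p.2 &
    p.1 * \big[*%R/1]_(s \in p.2) theta s = c]].

Section Frame.
Context {X : pmuSet K} {theta : amb K X -> K}.
Hypothesis fX : frame theta.
Local Notation nm := (nonmarked K X).
Local Notation tr := (Defs.transversal K n X).
Local Notation actX := (act K X).

Lemma frame_actK z x : mu z -> actX z^-1 (actX z x) = x.
Proof.
move=> muz; rewrite (frame_actM fX) //; last exact: muV.
by rewrite mulVf ?(frame_act1 fX) // (mu_neq0 n_gt0).
Qed.

Lemma frame_actVK z x : mu z -> actX z (actX z^-1 x) = x.
Proof. by move=> muz; rewrite -{1}[z]invrK frame_actK //; exact: muV. Qed.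

Lemma frame_free z w x : mu z -> mu w -> nm x -> actX z x = actX w x -> z = w.
Proof.
move=> muz muw nmx /(congr1 theta); rewrite !(frame_act fX) //.
by apply: mulIf; apply: (mu_neq0 n_gt0); exact: frame_mu fX _ nmx.
Qed.

(** On each free orbit theta is a bijection onto mu, so it takes the value 1 exactly once. This
    transversal provides a representative of every point of the determinant. *)
Lemma transversal_frame : tr [set x | nm x /\ theta x = 1].
Proof.
split=> [x []//|x nmx]; have mux := frame_mu fX nmx.
have nz := mu_neq0 n_gt0 mux.
exists (actX (theta x)^-1 x); split.
  split; last by exists (theta x); rewrite ?frame_actVK.
  split; first by apply: (frame_nonmarked fX) => //; exact: muV.
  by rewrite (frame_act fX) ?mulVf //; exact: muV.
move=> s [[nms s1] [z muz ->]].
by rewrite (frame_act fX) // s1 mulr1 frame_actK.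
Qed.

Lemma transversal_finite S : tr S -> finite_set S.
Proof. by case=> Snm _; exact: sub_finite_set Snm (frame_finite fX). Qed.

Lemma transversal_eq S x y z : tr S -> S x -> S y -> mu z -> y = actX z x -> x = y.
Proof.
move=> [Snm Str] Sx Sy muz yE; have [s [_ sU]] := Str y (Snm _ Sy).
rewrite -(sU x); last by split=> //; exists z.
by apply: sU; split=> //; exists 1; [exact: mu1|rewrite (frame_act1 fX)].
Qed.

Lemma transversal_twist_inj S r : tr S -> (forall s, S s -> mu (r s)) ->
  set_inj S (fun s => actX (r s) s).
Proof.
move=> Str rmu x y; rewrite !inE => Sx Sy /(congr1 (actX (r y)^-1)).
rewrite frame_actK ?(frame_actM fX) //; try (exact: rmu); last exact/muV/rmu.
by move=> xy; apply: (transversal_eq Str Sx Sy _ (esym xy)); exact: muM (muV (rmu _ _)) (rmu _ _).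
Qed.

Lemma transversal_twist S r : tr S -> (forall s, S s -> mu (r s)) ->
  tr [set actX (r s) s | s in S].
Proof.
move=> Str rmu; have [Snm SE] := Str; split=> [_ [s Ss <-]|x nmx].
  by apply: (frame_nonmarked fX); [exact: rmu|exact: Snm].
have [s [[Ss [z muz xE]] sU]] := SE x nmx; exists (actX (r s) s); split.
  split; first by exists s.
  exists (z / r s); first exact: muM muz (muV (rmu _ Ss)).
  rewrite (frame_actM fX) ?divfK //; [exact: (mu_neq0 n_gt0 (rmu _ Ss))| |exact: rmu].
  exact: muM muz (muV (rmu _ Ss)).
move=> _ [[s' Ss' <-] [w muw xE']].
rewrite (sU s') //; split=> //; exists (w * r s'); first exact: muM (rmu _ _).
by rewrite -(frame_actM fX) //; exact: rmu.
Qed.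

(** In each orbit the representatives from S and S' differ by a root of unity, which [r] selects. *)
Lemma transversal_change S S' : tr S -> tr S' ->
  exists r, (forall s, S s -> mu (r s)) /\ S' = [set actX (r s) s | s in S].
Proof.
move=> Str Str'; have [Snm SE] := Str; have [Snm' SE'] := Str'.
pose r s := xget 1 [set z | mu z /\ S' (actX z s)].
have rP s : S s -> mu (r s) /\ S' (actX (r s) s).
  move=> Ss; apply: (@xgetPex _ 1 [set z | mu z /\ S' (actX z s)]).
  have [s' [[Ss' [z muz sE]] _]] := SE' s (Snm _ Ss).
  by exists z^-1; rewrite /= sE frame_actK //; split=> //; exact: muV.
exists r; split=> [s /rP[]//|]; apply/seteqP; split=> [s' Ss'|_ [s /rP[_ ?] <-]//].
have [s [[Ss [z muz sE]] _]] := SE s' (Snm' _ Ss').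
have [mur Sr] := rP s Ss; exists s => //; symmetry.
apply: (transversal_eq Str' Ss' Sr (muM mur (muV muz))).
by rewrite sE (frame_actM fX) ?divfK ?(mu_neq0 n_gt0 muz) //; exact: muM mur (muV muz).
Qed.

(** By [transversal_change], passing to S' replaces each point by another point of its orbit, where
    the invariant function h has the same value. *)
Lemma fsprod_transversal (h : amb K X -> K) S S' :
  (forall z x, mu z -> nm x -> h (actX z x) = h x) -> tr S -> tr S' ->
  \big[*%R/1]_(s \in S) h s = \big[*%R/1]_(s \in S') h s.
Proof.
move=> hact Str Str'; have [r [rmu ->]] := transversal_change Str Str'.
rewrite fsbig_image; last exact: transversal_twist_inj.
apply: eq_fsbigr => s; rewrite inE => Ss; rewrite hact //; first exact: rmu.
by have [Snm _] := Str; exact: Snm.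
Qed.

Lemma fsprod_twist S r : tr S -> (forall s, S s -> mu (r s)) ->
  \big[*%R/1]_(s \in [set actX (r s) s | s in S]) theta s =
  \big[*%R/1]_(s \in S) r s * \big[*%R/1]_(s \in S) theta s.
Proof.
move=> Str rmu; rewrite fsbig_image; last exact: transversal_twist_inj.
rewrite -fsbig_split; last exact: transversal_finite.
apply: eq_fsbigr => s; rewrite inE => Ss; rewrite (frame_act fX) //; first exact: rmu.
by have [Snm _] := Str; exact: Snm.
Qed.

Lemma fsprod_frame_mu S : tr S -> mu (\big[*%R/1]_(s \in S) theta s).
Proof. by move=> [Snm _]; apply: mu_fsprod => s /Snm; exact: frame_mu. Qed.

(** Twisting S by r multiplies the product of theta by the product of r, which is exactly the factor
    that [det_class] removes from zeta; conversely, any two transversals are related by a twist. *)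
Lemma det_classE zeta S : mu zeta -> tr S ->
  det_class K n X zeta S = det_triv theta (zeta * \big[*%R/1]_(s \in S) theta s).
Proof.
move=> muz Str; apply/seteqP; split=> -[w T] /=.
  move=> [r [/= rmu -> zE]]; have mur := mu_fsprod rmu.
  split; last 1 first.
  - by rewrite fsprod_twist // mulrA -zE.
  - rewrite -[w](mulfK (mu_neq0 n_gt0 mur)) -zE; exact: muM muz (muV mur).
  - exact: transversal_twist.
move=> [/= muw Ttr]; have [r [rmu TE]] := transversal_change Str Ttr.
rewrite {1}TE fsprod_twist // mulrA => /(mulIf (mu_neq0 n_gt0 (fsprod_frame_mu Str))) zE.
by exists r.
Qed.

Lemma triv_det : trivialisation (n := n) (L := det K n X) (det_triv theta).
Proof.
split.
- move=> d; apply/seteqP; split=> [_ [[z S] dp <-] /=|[z S] dp]; rewrite ?mul1r //.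
  by exists (z, S); rewrite //= mul1r.
- move=> z w d _ _; apply/seteqP; split=> [_ [_ [[x S] dp <-] <-] /=|_ [[x S] dp <-] /=].
    by exists (x, S); rewrite //= mulrA.
  by exists (w * x, S); [exists (x, S)|rewrite /= mulrA].
- move=> z c muz muc; have zN := mu_neq0 n_gt0 muz.
  apply/seteqP; split=> [_ [[x S] [/= mux Str <-] <-] /=|[x S] [/= mux Str xc]].
    by split; rewrite ?mulrA //; exact: muM.
  exists (z^-1 * x, S); rewrite /= ?mulVKf //; split=> //=; first exact: muM (muV muz) mux.
  by rewrite -mulrA xc mulKf.
- move=> d; split=> [[zeta [S [muz Str ->]]]|[c muc ->]].
    exists (zeta * \big[*%R/1]_(s \in S) theta s); last exact: det_classE.
    exact: muM muz (fsprod_frame_mu Str).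
  have Str := transversal_frame.
  exists c, [set x | nm x /\ theta x = 1]; split=> //.
  by rewrite det_classE // fsbig1 ?mulr1 // => s [].
- move=> c d muc mud cd.
  have : det_triv theta c (c, [set x | nm x /\ theta x = 1]).
    by split=> //=; [exact: transversal_frame|rewrite fsbig1 ?mulr1 // => s []].
  by rewrite cd => -[_ _ <-]; rewrite /= fsbig1 ?mulr1 // => s [].
Qed.

Lemma det_triv_ex c : mu c -> exists p, det_triv theta c p.
Proof.
move=> muc; exists (c, [set x | nm x /\ theta x = 1]).
by split=> //=; [exact: transversal_frame|rewrite fsbig1 ?mulr1 // => s []].
Qed.

End Frame.

(** The union in [det_map] is a single class because the factor gamma is the same for every
    transversal. *)
Lemma det_map_triv X Y theta eta (f : amb K X -> amb K Y) gamma :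
  frame (X := X) theta -> frame (X := Y) eta -> 
  (forall S, Defs.transversal K n X S -> Defs.transversal K n Y (f @` S) /\
    \big[*%R/1]_(s \in f @` S) eta s = gamma * \big[*%R/1]_(s \in S) theta s) ->
  forall c, mu c -> det_map K n X Y f (det_triv theta c) = det_triv eta (gamma * c).
Proof.
move=> fX fY fS c muc.
have step p : det_triv theta c p -> det_class K n Y p.1 (f @` p.2) = det_triv eta (gamma * c).
  move=> [mup ptr <-]; have [fptr fpE] := fS _ ptr.
  by rewrite (det_classE fY) // fpE mulrCA.
apply/seteqP; split=> [q [p cp]|q qc]; first by rewrite step.
by have [p cp] := det_triv_ex fX muc; exists p; rewrite ?step.
Qed.

Lemma det_exact_triv X Y Z theta eta zeta (i : amb K X -> amb K Y)
    (p : amb K Y -> amb K Z) :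
  frame (X := X) theta -> frame (X := Y) eta -> frame (X := Z) zeta ->
  (forall S T, Defs.transversal K n X S -> Defs.transversal K n Z T ->
    let U := (i @` S) `|` (pts K Y `&` p @^-1` T) in
    Defs.transversal K n Y U /\ \big[*%R/1]_(s \in U) eta s =
      \big[*%R/1]_(s \in S) theta s * \big[*%R/1]_(s \in T) zeta s) ->
  forall c d, mu c -> mu d ->
    det_exact K n X Y Z i p (det_triv theta c) (det_triv zeta d) =
    det_triv eta (c * d).
Proof.
move=> fX fY fZ ip c d muc mud.
have step a b : det_triv theta c a -> det_triv zeta d b ->
    det_class K n Y (a.1 * b.1) ((i @` a.2) `|` (pts K Y `&` p @^-1` b.2)) =
    det_triv eta (c * d).
  move=> [mua atr <-] [mub btr <-]; have [utr uE] := ip _ _ atr btr.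
  by rewrite (det_classE fY) ?uE 1?mulrACA //; exact: muM.
apply/seteqP; split=> [q [a ca] [b db]|q qc]; first by rewrite step.
have [a ca] := det_triv_ex fX muc; have [b db] := det_triv_ex fZ mud.
by exists a => //; exists b; rewrite ?step.
Qed.

End Determinants.

(** * Orbits of the roots of unity in a finite field *)

Section FiniteField.
Variable k : finFieldType.

(** Translation by 1 permutes k, so the sum of all x + 1 equals the sum of all x; their difference
    is a sum of #|k| ones. *)
Lemma card_natr0 : #|k|%:R = 0 :> k.
Proof.
have : \sum_(x : k) (x + 1) = \sum_(x : k) x.
  by rewrite [RHS](reindex_inj (addIr 1)).
rewrite big_split /= sumr_const cardT -cardE => /(congr1 (fun y => y - \sum_(x : k) x)).
by rewrite addrAC subrr add0r.
Qed.

Context {n : nat} (n_gt0 : (0 < n)%N) (n_dvd : (n %| #|k| - 1)%N).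

Lemma expf_card_pred (u : k) : u != 0 -> u ^+ (#|k| - 1) = 1.
Proof.
move=> u0; apply: (mulfI u0); rewrite mulr1 -exprS subn1 prednK ?expf_card //.
by apply/card_gt0P; exists 0.
Qed.

(** The predicate under [pick] depends only on the orbit of u under the n-th roots of unity, so the
    choice is constant on orbits. For nonzero u the default 0 is not reached, since u itself
    satisfies the predicate. *)
Definition orbit_rep (u : k) : k := odflt 0 [pick d | (d != 0) && ((u / d) ^+ n == 1)].

(** An equivariant map from k^* to its n-th roots of unity, equal to 1 at the chosen
    representatives. *)
Definition angle (u : k) : k := u / orbit_rep u.

Lemma orbit_repP u : u != 0 -> orbit_rep u != 0 /\ angle u ^+ n = 1.
Proof.
move=> u0; rewrite /angle /orbit_rep; case: pickP => [d /andP[d0 /eqP]//|/(_ u)].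
by rewrite u0 divff // expr1n eqxx.
Qed.

Lemma orbit_repM z u : z ^+ n = 1 -> orbit_rep (z * u) = orbit_rep u.
Proof.
move=> z1; congr odflt; apply: eq_pick => d /=.
by rewrite -mulrA exprMn z1 mul1r.
Qed.

Lemma angleM z u : z ^+ n = 1 -> angle (z * u) = z * angle u.
Proof. by move=> z1; rewrite /angle orbit_repM // mulrA. Qed.

Lemma angle_neq0 u : u != 0 -> angle u != 0.
Proof. by move=> u0; rewrite mulf_neq0 ?invr_eq0 //; case: (orbit_repP u0). Qed.

Lemma angleK u : u != 0 -> angle u * orbit_rep u = u.
Proof. by move=> u0; rewrite divfK //; case: (orbit_repP u0). Qed.

Lemma orbit_rep_rep u : u != 0 -> orbit_rep (orbit_rep u) = orbit_rep u.
Proof.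
by move=> u0; rewrite -{2}(angleK u0) orbit_repM //; case: (orbit_repP u0).
Qed.

Definition orbit_reps : {set k} := finset (fun u => (u != 0) && (angle u == 1)).

Lemma orbit_repsP u : reflect (u != 0 /\ orbit_rep u = u) (u \in orbit_reps).
Proof.
rewrite inE; apply: (iffP andP) => -[u0 uE]; split=> //.
  by rewrite -[RHS](angleK u0) (eqP uE) mul1r.
by rewrite /angle uE divff.
Qed.

Lemma mem_orbit_reps u : u != 0 -> orbit_rep u \in orbit_reps.
Proof. by move=> u0; apply/orbit_repsP; split; [case: (orbit_repP u0)|exact: orbit_rep_rep]. Qed.

(** k^* is cyclic of order #|k| - 1, a multiple of n, so a power of a generator is a primitive n-th
    root of unity, and its n powers are all the roots. *)
Lemma card_unity_roots : #|finset (fun z : k => z ^+ n == 1)| = n.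
Proof.
have q1 : (0 < #|k| - 1)%N by rewrite subn_gt0 finNzRing_gt1.
have [w wP] : exists w : k, (#|k| - 1).-primitive_root w.
  have /hasP[w _ wP] : has (#|k| - 1).-primitive_root (enum [set~ (0 : k)]%SET).
    apply: cyclic.has_prim_root => //; last by rewrite -cardE cardsC1 subn1.
      by apply/allP => u; rewrite mem_enum !inE unity_rootE => u0; rewrite expf_card_pred.
    exact: enum_uniq.
  by exists w.
have zP := dvdn_prim_root wP n_dvd; set z := w ^+ _ in zP.
rewrite -[RHS]card_ord -(card_imset (f := fun i : 'I_n => z ^+ i)).
  apply: eq_card => x; rewrite inE; apply/eqP/imsetP => [x1|[i _ ->]].
    by have [i ->] := prim_rootP zP x1; exists i.
  by rewrite exprAC (prim_expr_order zP) expr1n.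
move=> i j /eqP; rewrite (eq_prim_root_expr zP) !modn_small // => /eqP.
exact: val_inj.
Qed.

(** Multiplication maps the pairs of a root of unity and a representative bijectively onto k^*. *)
Lemma card_orbit_reps : #|orbit_reps| = ((#|k| - 1) %/ n)%N.
Proof.
suff : (#|finset (fun z : k => z ^+ n == 1)%R| * #|orbit_reps| = #|k| - 1)%N.
  by rewrite card_unity_roots => <-; rewrite mulKn.
rewrite -cardsX subn1 -(cardsC1 0).
rewrite -(card_in_imset (f := fun p : k * k => p.1 * p.2)); last first.
  move=> [z d] [z' d']; rewrite !inE /= => /andP[/eqP z1 d1] /andP[/eqP z1' d1'] e.
  have /orbit_repsP[d0 dE] : d \in orbit_reps by rewrite inE.
  have /orbit_repsP[_ dE'] : d' \in orbit_reps by rewrite inE.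
  have dd : d = d' by rewrite -dE -dE' -(orbit_repM d z1) e orbit_repM.
  by rewrite -dd in e *; rewrite (mulIf d0 e).
apply: eq_card => u; rewrite !inE; apply/imsetP/idP => [[[z d]]|u0].
  rewrite !inE /= => /andP[/eqP z1 /andP[d0 _]] ->; rewrite mulf_neq0 //.
  by apply: contra_eq_neq z1 => ->; rewrite expr0n gtn_eqF // eq_sym oner_eq0.
exists (angle u, orbit_rep u); last by rewrite /= angleK.
rewrite finset.in_setX mem_orbit_reps //= inE; apply/andP; split=> //.
by apply/eqP; case: (orbit_repP u0).
Qed.

(* Multiplication by c permutes the orbits, and angle (c * u) is the factor by
   which c * u differs from a representative; the product of all the
   representatives cancels. *)
Lemma prod_angle c : c != 0 ->
  \prod_(u in orbit_reps) angle (c * u) = c ^+ ((#|k| - 1) %/ n).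
Proof.
move=> c0; rewrite -card_orbit_reps.
have reps0 : \prod_(u in orbit_reps) u != 0.
  by apply/prodf_neq0 => u /orbit_repsP[].
apply: (mulIf reps0); rewrite [RHS]mulrC -prodrMr.
rewrite [RHS](eq_bigr (fun u => angle (c * u) * orbit_rep (c * u))); last first.
  by move=> u /orbit_repsP[u0 _]; rewrite angleK; [exact: mulrC|exact: mulf_neq0].
rewrite [RHS]big_split /=; congr (_ * _); pose h u := orbit_rep (c * u).
(* If c u and c w have the same representative, then u and w lie in one orbit, and each of them is
   its chosen representative. *)
have h_inj : {in orbit_reps &, injective h}.
  move=> u w /orbit_repsP[u0 uE] /orbit_repsP[w0 wE] uw.
  have [cu0 cw0] : c * u != 0 /\ c * w != 0 by rewrite !mulf_neq0.
  have [/= h0 au] := orbit_repP cu0; have [_ aw] := orbit_repP cw0.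
  have uwE : u = angle (c * u) / angle (c * w) * w.
    apply: (mulfI c0); rewrite mulrCA -[LHS](angleK cu0) -/(h u) uw -[RHS]mulrA.
    congr (_ * _); apply: (mulfI (angle_neq0 cw0)).
    by rewrite mulVKf ?angle_neq0 // angleK.
  by rewrite -uE uwE orbit_repM // exprMn exprVn au aw mulfV ?oner_neq0.
rewrite -(big_imset (fun u => u) h_inj); apply: eq_bigl => u.
(* An injective self-map of a finite set is onto. *)
suff -> : imset h (mem orbit_reps) = orbit_reps by [].
apply/eqP; rewrite eqEcard card_in_imset // leqnn andbT.
apply/fintype.subsetP => _ /imsetP[w /orbit_repsP[w0 _] ->].
by rewrite mem_orbit_reps // mulf_neq0.
Qed.

End FiniteField.

(** * Valuation, residues and Teichmuller representatives *)

Section LocalField.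
Context {K : fieldType} {v : K -> int} { pi : K} {k : finFieldType} {red : K -> k}.
Hypothesis KL : local_field0 v pi red.
Local Notation P := (val_ge v).
Local Notation q := #|k|.

Let vP := local_valuation KL.
Let resP := local_residue KL.
Let pi0 : pi != 0 := (local_uniformiser KL).1.
Let v_pi : v pi = 1 := (local_uniformiser KL).2.

Lemma val_mul x y : x != 0 -> y != 0 -> v (x * y) = v x + v y.
Proof. exact: valuationM vP x y. Qed.

Lemma val_one : v 1 = 0.
Proof. by apply: (addrI (v 1)); rewrite addr0 -val_mul ?oner_neq0 // mulr1. Qed.

Lemma val_inv x : x != 0 -> v x^-1 = - v x.
Proof.
move=> x0; have := val_mul x0 (invr_neq0 x0).
by rewrite mulfV // val_one; lia.
Qed.

Lemma val_exp x m : x != 0 -> v (x ^+ m) = v x * m%:Z.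
Proof.
move=> x0; elim: m => [|m IH]; first by rewrite expr0 val_one mulr0.
by rewrite exprS val_mul ?expf_neq0 // IH; lia.
Qed.

Lemma val_expz x (z : int) : x != 0 -> v (x ^ z) = v x * z.
Proof.
move=> x0; case: z => m; first exact: val_exp.
by rewrite NegzE -exprnN val_inv ?expf_neq0 // val_exp //; lia.
Qed.

Lemma val_opp x : v (- x) = v x.
Proof.
have [->|x0] := eqVneq x 0; first by rewrite oppr0.
have N1 : (-1 : K) != 0 by rewrite oppr_eq0 oner_neq0.
have := val_mul N1 N1; rewrite mulrNN mulr1 val_one => v1.
by rewrite -mulN1r val_mul //; lia.
Qed.

Lemma val_unity x m : (0 < m)%N -> x ^+ m = 1 -> x != 0 /\ v x = 0.
Proof.
move=> m0 xm; have x0 : x != 0.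
  by apply: contra_eq_neq xm => ->; rewrite expr0n gtn_eqF // eq_sym oner_neq0.
by split=> //; have := val_exp m x0; rewrite xm val_one; nia.
Qed.

Lemma val_ge_val x : P (v x) x. Proof. by right. Qed.

Lemma val_geN0 i x : ~ P i x -> x != 0 /\ v x < i.
Proof.
move=> Px; split; first by apply/eqP => x0; apply: Px; left.
by rewrite ltNge; apply/negP => ix; apply: Px; right.
Qed.

Lemma val_geE i x : x != 0 -> P i x <-> i <= v x.
Proof. by move=> /eqP x0; split=> [[]//|?]; right. Qed.

Lemma val_ge_le i j x : i <= j -> P j x -> P i x.
Proof. by move=> ij [->|jx]; [left|right; exact: le_trans ij jx]. Qed.

Lemma val_geD i x y : P i x -> P i y -> P i (x + y).
Proof.
have [->|x0] := eqVneq x 0; first by rewrite add0r.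
have [->|y0] := eqVneq y 0; first by rewrite addr0.
have [->|xy0] := eqVneq (x + y) 0; first by left.
move=> /(val_geE _ x0) ix /(val_geE _ y0) iy; right.
by apply: le_trans (valuationD vP x0 y0 xy0); rewrite le_min ix.
Qed.

Lemma val_geN i x : P i (- x) <-> P i x.
Proof.
by rewrite /val_ge /= val_opp; split=> -[/eqP xE|xE]; [left|right|left|right] => //;
  apply/eqP; rewrite ?oppr_eq0 // in xE *.
Qed.

Lemma val_geB i x y : P i x -> P i y -> P i (x - y).
Proof. by move=> ix /val_geN; exact: val_geD. Qed.

Lemma val_ge_sym i x y : P i (x - y) -> P i (y - x).
Proof. by rewrite -opprB => /val_geN. Qed.

Lemma val_ge_trans i x y z : P i (x - y) -> P i (y - z) -> P i (x - z).
Proof. by move=> xy yz; rewrite -(subrK y x) -addrA; exact: val_geD. Qed.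

Lemma val_geM i j x y : P i x -> P j y -> P (i + j) (x * y).
Proof.
have [->|x0] := eqVneq x 0; first by rewrite mul0r; left.
have [->|y0] := eqVneq y 0; first by rewrite mulr0; left.
move=> /(val_geE _ x0) ix /(val_geE _ y0) iy; right.
by rewrite val_mul // lerD.
Qed.

Lemma val_geMl i x y : x != 0 -> P (v x + i) (x * y) <-> P i y.
Proof.
move=> x0; split=> [xy|iy]; last exact: val_geM (val_ge_val x) iy.
have -> : i = - v x + (v x + i) by lia.
by rewrite -[y](mulKf x0) -val_inv //; apply: val_geM xy; exact: val_ge_val.
Qed.

Lemma val_ge_sum (I : Type) (r : seq I) (F : I -> K) i :
  (forall j, P i (F j)) -> P i (\sum_(j <- r) F j).
Proof. by move=> iF; apply: big_ind => // [|x y]; [left|exact: val_geD]. Qed.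

(** If y were zero or of larger valuation than x, then x = y - (y - x) would itself have order above
    v x. *)
Lemma val_lead x y : x != 0 -> P (v x + 1) (y - x) -> y != 0 /\ v y = v x.
Proof.
move=> x0 yx; have y0 : y != 0.
  apply/eqP => y0; move: yx; rewrite y0 sub0r => /val_geN /(val_geE _ x0); lia.
split=> //; have xy : P (v x) y.
  by rewrite -(subrK x y); apply: val_geD (val_ge_val x); apply: val_ge_le yx; lia.
move: xy => /(val_geE _ y0) xy; apply/eqP; rewrite eq_le xy andbT leNgt; apply/negP => lt.
have : P (v x + 1) x.
  rewrite -[X in P _ X](subKr y x); apply: val_geB yx; apply: val_ge_le (val_ge_val y); lia.
by move=> /(val_geE _ x0); lia.
Qed.

Local Notation O := (val_ring v).

Lemma val_ringM x y : O x -> O y -> O (x * y).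
Proof. exact: val_geM. Qed.

Lemma val_ring1 : O 1. Proof. by right; rewrite val_one. Qed.

Lemma val_ringX x m : O x -> O (x ^+ m).
Proof.
move=> Ox; elim: m => [|m IH]; first exact: val_ring1.
by rewrite exprS; exact: val_ringM.
Qed.

Lemma redD x y : O x -> O y -> red (x + y) = red x + red y.
Proof. exact: residueD resP x y. Qed.

Lemma redM x y : O x -> O y -> red (x * y) = red x * red y.
Proof. exact: residueM resP x y. Qed.

Lemma red1 : red 1 = 1. Proof. exact: residue1 resP. Qed.

Lemma redX x m : O x -> red (x ^+ m) = red x ^+ m.
Proof.
move=> Ox; elim: m => [|m IH]; first exact: red1.
by rewrite !exprS redM ?IH //; exact: val_ringX.
Qed.

Lemma red_eq0 x : O x -> red x = 0 <-> P 1 x.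
Proof.
move=> Ox; apply: (iff_trans (residue_ker resP Ox)); split=> [[y Oy ->]|].
  by rewrite -v_pi -[v pi]addr0; apply/val_geMl.
rewrite -{1}(mulVKf pi0 x) -v_pi -[v pi]addr0 => /(val_geMl _ _ pi0) Oy.
by exists (pi^-1 * x); rewrite ?mulVKf.
Qed.

Lemma red_sum (I : Type) (r : seq I) (F : I -> K) :
  (forall j, O (F j)) -> red (\sum_(j <- r) F j) = \sum_(j <- r) red (F j).
Proof.
move=> OF; elim: r => [|j r IH].
  by rewrite !big_nil; apply/red_eq0; left.
by rewrite !big_cons redD ?IH //; exact: val_ge_sum.
Qed.

Lemma redB x y : O x -> O y -> red (x - y) = red x - red y.
Proof.
move=> Ox Oy; have Oxy : O (x - y) by exact: (val_geB Ox Oy).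
by apply: (addIr (red y)); rewrite -redD // !subrK. 
Qed.

Lemma red_eq x y : O x -> O y -> red x = red y <-> P 1 (x - y).
Proof.
move=> Ox Oy; have := red_eq0 (val_geB Ox Oy); rewrite redB // => xy.
by split=> [e|/xy/eqP]; [apply/xy; rewrite e subrr|rewrite subr_eq0 => /eqP].
Qed.

Lemma val_pi (i : int) : v (pi ^ i) = i.
Proof. by rewrite val_expz // v_pi mul1r. Qed.

Lemma expfz_pi (i : int) : pi ^ i != 0.
Proof. exact: expfz_neq0. Qed.

(** In x^q - y^q = (x - y) * sum of x^(q-1-j) y^j, the second factor reduces to q times a power of
    the common residue, hence to 0, which gains one order. *)
Lemma pow_card_sub x y i : O x -> O y -> P 1 (x - y) -> P i (x - y) ->
  P (i + 1) (x ^+ q - y ^+ q).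
Proof.
move=> Ox Oy /(red_eq Ox Oy) xy ixy; rewrite subrXX; apply: val_geM => //.
have OF (j : 'I_q) : O (x ^+ (q.-1 - j) * y ^+ j).
  by apply: val_ringM; exact: val_ringX.
apply/red_eq0; first exact: val_ge_sum.
rewrite red_sum // (eq_bigr (fun=> red y ^+ q.-1)).
  by rewrite sumr_const card_ord -mulr_natr card_natr0 mulr0.
move=> j _; rewrite redM ?redX ?xy -?exprD ?subnK //; try exact: val_ringX.
by rewrite -ltnS (ltn_predK (ltn_ord j)).
Qed.

(** A nonzero difference of two such fixed points would, by [pow_card_sub], have valuation larger
    than its own. *)
Lemma pow_card_inj x y : O x -> O y -> x ^+ q = x -> y ^+ q = y ->
  red x = red y -> x = y.
Proof.
move=> Ox Oy xq yq xy; apply/eqP; rewrite -subr_eq0; apply: contraT => d0.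
have := pow_card_sub Ox Oy ((red_eq Ox Oy).1 xy) (val_ge_val _).
by rewrite xq yq => /(val_geE _ d0); rewrite gerDl.
Qed.

Lemma val_ge_all0 x : (forall m : nat, P m%:Z x) -> x = 0.
Proof.
move=> Px; apply/eqP; apply: contraT => x0.
by have /(val_geE _ x0) := Px (absz (v x)).+1; lia.
Qed.

Lemma teichmuller_ex c : exists x, [/\ O x, x ^+ q = x & red x = c].
Proof.
have [x0 Ox0 x0c] := residue_surj resP c.
(* The iterated q-th powers of a lift of c keep the residue c, and by [pow_card_sub] consecutive
   ones get closer by one order at each step. *)
pose u m := x0 ^+ (q ^ m); have Ou m : O (u m) by exact: val_ringX.
have uS m : u m.+1 = u m ^+ q by rewrite /u expnSr exprM.
have uc m : red (u m) = c.
  by elim: m => [|m IH]; [rewrite /u expn0 expr1|rewrite uS redX ?IH ?expf_card].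
have u1 m p : P 1 (u m - u p) by apply/red_eq => //; rewrite !uc.
have step m : P (m%:Z + 1) (u m.+1 - u m).
  elim: m => [|m IH]; first exact: u1.
  by rewrite (uS m.+1) {2}uS intS [1 + _]addrC; exact: pow_card_sub.
have uP m p : P (m%:Z + 1) (u (m + p)%N - u m).
  elim: p => [|p IH]; first by rewrite addn0 subrr; left.
  rewrite addnS; apply: val_ge_trans IH; apply: val_ge_le (step _); lia.
have [N|l lP] := local_complete KL (u := u).
  exists (absz N) => i j iN jN.
  rewrite -(subnKC iN) -(subnKC jN).
  have NN : N <= (absz N)%:Z + 1 by lia.
  apply: val_ge_le NN _; apply: (val_ge_trans (y := u (absz N))) (uP _ _) _.
  exact: val_ge_sym.
have Ol : O l.
  have [m /(_ m (leqnn m)) ml] := lP 0.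
  by rewrite -(subKr (u m) l); exact: val_geB (Ou m) ml.
exists l; split=> //; last first.
  have [m /(_ m (leqnn m)) ml] := lP 1.
  by rewrite -(uc m); apply/red_eq => //; exact: val_ge_sym.
(* The term u p.+1 = u p ^+ q is close to l ^+ q by [pow_card_sub], and close to l by
   convergence. *)
apply/eqP; rewrite -subr_eq0; apply/eqP/val_ge_all0 => m.
have [p /= pP] := lP (m%:Z + 1).
have up : P 1 (u p - l) by apply: val_ge_le (pP p _) => //; lia.
apply: (val_ge_trans (y := u p.+1)).
  apply: val_ge_sym; rewrite uS.
  by apply: val_ge_le (pow_card_sub (Ou p) Ol up (pP p (leqnn p))); lia.
by apply: val_ge_le (pP p.+1 _) => //; lia.
Qed.

(** The chosen fixed point of the q-th power is unique by [pow_card_inj], which makes this section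
    of the reduction multiplicative. *)
Definition teichmuller (c : k) : K := xget 0 [set x | [/\ O x, x ^+ q = x & red x = c]].

Local Notation tei := teichmuller.

Lemma teichmullerP c : [/\ O (tei c), tei c ^+ q = tei c & red (tei c) = c].
Proof. exact: (@xgetPex _ 0 [set x | [/\ O x, x ^+ q = x & red x = c]] (teichmuller_ex c)). Qed.

Lemma red_tei c : red (tei c) = c. Proof. by case: (teichmullerP c). Qed.
Lemma val_ring_tei c : O (tei c). Proof. by case: (teichmullerP c). Qed.

Lemma tei_red x : O x -> x ^+ q = x -> tei (red x) = x.
Proof.
by move=> Ox xq; have [Ot tq tr] := teichmullerP (red x); exact: pow_card_inj.
Qed.

Lemma tei_inj : injective tei.
Proof. by move=> c d /(congr1 red); rewrite !red_tei. Qed.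

Lemma teiM c d : tei (c * d) = tei c * tei d.
Proof.
have [Oc cq cr] := teichmullerP c; have [Od dq dr] := teichmullerP d.
rewrite -[in LHS]cr -[in LHS]dr -redM // tei_red ?exprMn ?cq ?dq //.
exact: val_ringM.
Qed.

Lemma tei1 : tei 1 = 1.
Proof. by rewrite -[in LHS]red1 tei_red ?expr1n //; exact: val_ring1. Qed.

Lemma teiX c m : tei (c ^+ m) = tei c ^+ m.
Proof. by elim: m => [|m IH]; rewrite ?expr0 ?tei1 // !exprS teiM IH. Qed.

Lemma tei_neq0 c : c != 0 -> tei c != 0 /\ v (tei c) = 0.
Proof.
move=> c0; apply: (@val_unity _ (q - 1)); first by rewrite subn_gt0 finNzRing_gt1.
by rewrite -teiX expf_card_pred ?tei1.
Qed.

(** The angular component with respect to pi. It is multiplicative on all of K^*, whereas [red] is a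
    morphism only on O. *)
Definition lead (x : K) : k := red (x * pi ^ (- v x)).

Lemma val_lead_arg x : x != 0 -> O (x * pi ^ (- v x)).
Proof. by move=> x0; right; rewrite val_mul ?expfz_pi // val_pi subrr. Qed.

Lemma lead_neq0 x : x != 0 -> lead x != 0.
Proof.
move=> x0; apply/eqP => /red_eq0 -/(_ (val_lead_arg x0)).
have y0 : x * pi ^ (- v x) != 0 by rewrite mulf_neq0 // expfz_pi.
by move=> /(val_geE _ y0); rewrite val_mul ?expfz_pi // val_pi; lia.
Qed.

Lemma leadM x y : x != 0 -> y != 0 -> lead (x * y) = lead x * lead y.
Proof.
move=> x0 y0; rewrite /lead -redM; try exact: val_lead_arg.
by rewrite val_mul // opprD expfzDr // mulrACA.
Qed.

Lemma lead_red x : v x = 0 -> lead x = red x.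
Proof. by move=> vx; rewrite /lead vx oppr0 expr0z mulr1. Qed.

Lemma lead1 : lead 1 = 1. Proof. by rewrite lead_red ?val_one // red1. Qed.

Lemma leadV x : x != 0 -> lead x^-1 = (lead x)^-1.
Proof.
move=> x0; apply: (mulfI (lead_neq0 x0)).
by rewrite -leadM ?invr_eq0 // !mulfV ?lead1 ?lead_neq0.
Qed.

Lemma leadXz x (z : int) : x != 0 -> lead (x ^ z) = lead x ^ z.
Proof.
move=> x0; have aux m : lead (x ^+ m) = lead x ^+ m.
  elim: m => [|m IH]; first by rewrite !expr0 lead1.
  by rewrite !exprS leadM ?IH ?expf_neq0.
case: z => m; first exact: aux.
by rewrite NegzE -!exprnN leadV ?expf_neq0 // aux.
Qed.

Lemma lead_pi (i : int) : lead (pi ^ i) = 1.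
Proof. by rewrite /lead val_pi -expfzDr // subrr expr0z red1. Qed.

Lemma lead_eq x y : x != 0 -> P (v x + 1) (y - x) -> lead y = lead x.
Proof.
move=> x0 yx; have [y0 vy] := val_lead x0 yx.
apply/red_eq; try exact: val_lead_arg.
rewrite vy -mulrBl -[1](addrK (v x)) addrAC.
by rewrite [X in P X](_ : _ = v x + 1 + - v x); [apply: val_geM => //; right; rewrite val_pi|lia].
Qed.

Lemma lead_tei c (i : int) : c != 0 ->
  [/\ tei c * pi ^ i != 0, v (tei c * pi ^ i) = i & lead (tei c * pi ^ i) = c].
Proof.
move=> c0; have [t0 vt] := tei_neq0 c0; split; first by rewrite mulf_neq0 // expfz_pi.
  by rewrite val_mul ?expfz_pi // vt val_pi add0r.
by rewrite leadM ?expfz_pi // lead_pi mulr1 lead_red // red_tei.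
Qed.

(** Truncated pi-adic expansion with Teichmuller digits, starting at pi ^ i. By [dig_ex] and
    [dig_inj], the N-tuples of digits represent each class of P i / P (i + N) exactly once. *)
Fixpoint dig (i : int) (s : seq k) : K :=
  if s is c :: s' then tei c * pi ^ i + dig (i + 1) s' else 0.

Lemma val_ge_tei i c : P i (tei c * pi ^ i).
Proof.
rewrite -[X in P X]add0r; apply: val_geM; first exact: val_ring_tei.
by right; rewrite val_pi.
Qed.

Lemma val_ge_dig i s : P i (dig i s).
Proof.
elim: s i => [|c s IH] i /=; first by left.
apply: val_geD (val_ge_tei i c) _; apply: val_ge_le (IH _); lia.
Qed.

Lemma digit_ex i x : P i x -> P (i + 1) (x - tei (red (x * pi ^ (- i))) * pi ^ i).
Proof.
move=> ix; set y := x * _; have Oy : O y.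
  by rewrite /val_ring -(subrr i); apply: val_geM => //; right; rewrite val_pi.
have -> : x = y * pi ^ i by rewrite -mulrA -expfzDr // addNr expr0z mulr1.
rewrite -mulrBl addrC; apply: val_geM; last by right; rewrite val_pi.
by apply/red_eq => //; [exact: val_ring_tei|rewrite red_tei].
Qed.

Lemma digit_inj i c d : P (i + 1) (tei c * pi ^ i - tei d * pi ^ i) -> c = d.
Proof.
rewrite -mulrBl mulrC -{1}(val_pi i) => /(val_geMl _ _ (expfz_pi i)).
by move=> /red_eq; rewrite !red_tei; apply; exact: val_ring_tei.
Qed.

Lemma dig_ex N i x : P i x -> exists t : N.-tuple k, P (i + N%:Z) (x - dig i t).
Proof.
elim: N i x => [|N IH] i x ix.
  by exists [tuple]; rewrite addr0 subr0.
have [t tP] := IH _ _ (digit_ex ix).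
exists (cons_tuple (red (x * pi ^ (- i))) t) => /=.
by rewrite intS addrA opprD addrA.
Qed.

Lemma dig_inj N i (s t : N.-tuple k) : P (i + N%:Z) (dig i s - dig i t) -> s = t.
Proof.
elim: N i s t => [|N IH] i s t; first by rewrite (tuple0 s) (tuple0 t).
case/tupleP: s => c s; case/tupleP: t => d t /=.
rewrite intS addrA => st; have cd : c = d.
  (* All later digits contribute order at least i + 1, so the difference of the two first terms
     alone has that order. *)
  apply: (@digit_inj i); have dd u : P (i + 1) (dig (i + 1) u) by exact: val_ge_dig.
  rewrite (_ : _ - _ = tei c * pi ^ i + dig (i + 1) s - (tei d * pi ^ i + dig (i + 1) t)
    - (dig (i + 1) s - dig (i + 1) t)); last by ring.
  by apply: val_geB (val_geB (dd _) (dd _)); apply: val_ge_le st; lia.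
by rewrite cd opprD addrACA subrr add0r in st *; rewrite (IH _ _ _ st).
Qed.

End LocalField.

(** * Quotients of fractional ideals *)

Section Cosets.
Context {K : fieldType} {v : K -> int} { pi : K} {k : finFieldType} {red : K -> k}.
Context {n : nat}.
Hypotheses (KL : local_field0 v pi red) (n_gt0 : (0 < n)%N) (n_dvd : (n %| #|k| - 1)%N).
Local Notation P := (val_ge v).
Local Notation O := (val_ring v).
Local Notation mu := (mu K n).
Local Notation tei := (teichmuller (v := v) (red := red)).
Local Notation lead := (lead (v := v) (pi := pi) (red := red)).
Local Notation dig := (dig (v := v) (pi := pi) (red := red)).

Lemma mu_val z : mu z -> z != 0 /\ v z = 0.
Proof. by move=> muz; exact: (val_unity KL n_gt0 muz). Qed.

Lemma mu_val_ring z : mu z -> O z.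
Proof. by move=> /mu_val[_ vz]; right; rewrite vz. Qed.

Lemma mu_card z : mu z -> z ^+ #|k| = z.
Proof.
move=> muz; have q0 : (0 < #|k|)%N by apply/card_gt0P; exists 0.
rewrite -(subnK q0) addn1 exprS -(divnK n_dvd) mulnC exprM muz expr1n mulr1 //.
Qed.

Lemma mu_cardX z N : mu z -> z ^+ (#|k| ^ N) = z.
Proof.
by move=> muz; elim: N => [|N IH]; rewrite ?expn0 ?expr1 // expnSr exprM IH mu_card.
Qed.

Lemma mu_tei c : c ^+ n = 1 -> mu (tei c).
Proof. by move=> c1; rewrite /Defs.mu /= -(teiX KL) c1 (tei1 KL). Qed.

(** Roots of unity of order dividing n are fixed by the q-th power because n divides q - 1; so
    reduction identifies them with those of k, with inverse [tei]. *)
Lemma tei_mu z : mu z -> tei (red z) = z.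
Proof. by move=> muz; rewrite (tei_red KL) ?mu_card //; exact: mu_val_ring. Qed.

Lemma red_mu z : mu z -> red z ^+ n = 1.
Proof.
move=> muz; rewrite -(redX KL) ?muz ?(red1 KL) //; exact: mu_val_ring.
Qed.

Definition theta (x : K) : K := tei (angle (n := n) (lead x)).

Lemma theta_mu x : x != 0 -> mu (theta x).
Proof.
move=> x0; apply: mu_tei.
by have [_ ->] := orbit_repP (n := n) (lead_neq0 KL x0).
Qed.

Lemma thetaM z x : mu z -> x != 0 -> theta (z * x) = z * theta x.
Proof.
move=> muz x0; have [z0 vz] := mu_val muz.
rewrite /theta (leadM KL) // lead_red // angleM ?red_mu //.
by rewrite (teiM KL) tei_mu.
Qed.

Definition coset (j : int) (x : K) : set K := addset K [set x] (P j).

Lemma cosetE j x y : coset j x y <-> P j (y - x).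
Proof.
split=> [[_ -> [z jz <-]]|yx]; first by rewrite addrC addKr.
by exists x => //; exists (y - x) => //; rewrite addrC subrK.
Qed.

Lemma coset_id j x : coset j x x.
Proof. by apply/cosetE; rewrite subrr; left. Qed.

Lemma coset_eq j x y : coset j x = coset j y <-> P j (x - y).
Proof.
split=> [xy|xy]; first by apply/cosetE; rewrite -xy; exact: coset_id.
apply/seteqP; split=> z /cosetE zx; apply/cosetE.
  exact: (val_ge_trans KL) zx xy.
exact: (val_ge_trans KL) zx (val_ge_sym KL xy).
Qed.

Lemma coset_ge j : P j = coset j 0.
Proof. by apply/seteqP; split=> x; rewrite cosetE subr0. Qed.

Lemma coset_addset j l x : j <= l -> addset K (coset l x) (P j) = coset j x.
Proof.
move=> jl; apply/seteqP; split=> [_ [y /cosetE yx [z jz <-]]|y /cosetE yx].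
  apply/cosetE; rewrite addrAC; apply: (val_geD KL) jz.
  exact: val_ge_le jl yx.
exists x; first exact: coset_id.
by exists (y - x) => //; rewrite addrC subrK.
Qed.

Lemma scale_coset f j x : f != 0 -> scale K f (coset j x) = coset (v f + j) (f * x).
Proof.
move=> f0; apply/seteqP; split=> [_ [y /cosetE yx <-]|y /cosetE yx].
  by apply/cosetE; rewrite -mulrBr; apply/(val_geMl KL).
exists (f^-1 * y); last by rewrite mulVKf.
by apply/cosetE; apply/(val_geMl KL _ _ f0); rewrite mulrBr mulVKf.
Qed.

Lemma scale_mu_coset z j x : mu z -> scale K z (coset j x) = coset j (z * x).
Proof. by move=> /mu_val[z0 vz]; rewrite scale_coset // vz add0r. Qed.

Lemma scale_val_ge f i : f != 0 -> scale K f (P i) = P (v f + i).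
Proof. by move=> f0; rewrite !coset_ge scale_coset // mulr0. Qed.

(** The leading term is constant on a coset other than P j, so the element picked by [xget] does not
    matter there. *)
Definition ctheta (E : set K) : K := theta (xget 0 E).

Lemma lead_coset j x : ~ P j x -> lead (xget 0 (coset j x)) = lead x.
Proof.
move=> /(val_geN0)[x0 vx]; have /cosetE yx : coset j x (xget 0 (coset j x)).
  by apply: xgetPex; exists x; exact: coset_id.
by apply: (lead_eq KL x0); apply: val_ge_le yx; lia.
Qed.

Lemma ctheta_coset j x : ~ P j x -> ctheta (coset j x) = theta x.
Proof. by move=> jx; rewrite /ctheta /theta lead_coset. Qed.

Local Notation Q i j := (quot K (P i) (P j)).

Lemma nonmarkedP i j E :
  nonmarked K (Q i j) E <-> exists x, [/\ P i x, ~ P j x & E = coset j x].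
Proof.
have markE x : coset j x = P j <-> P j x.
  by have := coset_eq j x 0; rewrite subr0 -coset_ge.
split=> [[[x ix <-] /= Ej]|[x [ix jx ->]]].
  by exists x; split=> // jx; apply: Ej; apply/markE.
by split=> /=; [exists x|move=> /markE].
Qed.

Lemma pts_quot i j N : j = i + N%:Z ->
  pts K (Q i j) = [set coset j (dig i (val t)) | t in [set: N.-tuple k]].
Proof.
move=> jE; apply/seteqP; split=> [_ [x ix <-]|_ [t _ <-]].
  have [t tP] := dig_ex KL N ix; exists t => //.
  by apply/coset_eq; rewrite jE; exact: (val_ge_sym KL).
by exists (dig i (val t)) => //; exact: (val_ge_dig KL).
Qed.

Lemma finite_quot i j : i <= j -> finite_set (pts K (Q i j)).
Proof.
move=> ij; rewrite (@pts_quot i j (absz (j - i))); last by lia.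
exact: finite_image.
Qed.

Lemma frame_quot i j : i <= j -> frame (n := n) (X := Q i j) ctheta.
Proof.
move=> ij; split.
- by apply: sub_finite_set (finite_quot ij) => x [].
- by move=> E; apply/seteqP; split=> [_ [y Ey <-]|y Ey]; rewrite ?mul1r //; exists y; rewrite ?mul1r.
- move=> z w E _ _; apply/seteqP; split=> [_ [_ [y Ey <-] <-]|_ [y Ey <-]].
    by exists y; rewrite ?mulrA.
  by exists (w * y); [exists y|rewrite mulrA].
- move=> z E muz /nonmarkedP[x [ix jx ->]]; have [z0 vz] := mu_val muz.
  apply/nonmarkedP; exists (z * x); rewrite /= scale_mu_coset //; split=> //.
    by rewrite -[i]add0r -vz; apply/(val_geMl KL).
  by rewrite -[j]add0r -vz => /(val_geMl KL _ _ z0).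
- move=> E /nonmarkedP[x [ix jx ->]]; rewrite ctheta_coset //.
  by apply: theta_mu; case: (val_geN0 jx).
- move=> z E muz /nonmarkedP[x [ix jx ->]]; have [z0 vz] := mu_val muz.
  rewrite /= scale_mu_coset // !ctheta_coset //; last first.
    by rewrite -[j]add0r -vz => /(val_geMl KL _ _ z0).
  by rewrite thetaM //; case: (val_geN0 jx).
Qed.

(** * Exact sequences P j / P l -> P i / P l -> P i / P j *)

Section Chain.
Context {i j l : int} (ij : i <= j) (jl : j <= l).

(* The fibres of A/C -> A/B are torsors under B/C, whose cardinality is a power
   of #|k| and hence 1 modulo n. *)
Lemma fsprod_fibres (T : set (set K)) (h : set K -> K) :
  T `<=` nonmarked K (Q i j) -> (forall E, T E -> mu (h E)) ->
  (forall x, P i x -> ~ P j x -> h (coset l x) = h (coset j x)) ->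
  \big[*%R/1]_(E \in pts K (Q i l) `&` addset K ^~ (P j) @^-1` T) h E =
  \big[*%R/1]_(E \in T) h E.
Proof.
move=> Tnm hmu hlj; pose N := absz (l - j); have lE : l = j + N%:Z by lia.
(* The fibre over a coset E is parametrised by adding to a chosen element of E the digit expansions
   that represent P j / P l. *)
pose f (p : set K * N.-tuple k) := coset l (xget 0 p.1 + dig j (val p.2)).
have rep E : T E -> [/\ P i (xget 0 E), ~ P j (xget 0 E) & E = coset j (xget 0 E)].
  move=> /Tnm/nonmarkedP[x [ix jx ->]].
  have /cosetE yx : coset j x (xget 0 (coset j x)).
    by apply: xgetPex; exists x; exact: coset_id.
  set y := xget _ _ in yx *; split; last exact/coset_eq/(val_ge_sym KL).
    by rewrite -(subrK x y); apply: (val_geD KL) ix; exact: val_ge_le yx.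
  by move=> jy; apply: jx; rewrite -(subKr y x); exact: (val_geB KL).
have repD E (t : seq k) : T E -> [/\ P i (xget 0 E + dig j t), ~ P j (xget 0 E + dig j t)
    & E = coset j (xget 0 E + dig j t)].
  move=> /rep[ix jx EE]; have jd := val_ge_dig KL j t; split.
  - by apply: (val_geD KL) ix _; exact: val_ge_le jd.
  - by move=> jy; apply: jx; rewrite -(addrK (dig j t) (xget 0 E)); exact: (val_geB KL).
  - by rewrite {1}EE; apply/coset_eq; rewrite opprD addNKr; apply/(val_geN KL).
have f_bij : set_bij (T `*` [set: N.-tuple k])
    (pts K (Q i l) `&` addset K ^~ (P j) @^-1` T) f.
  split.
  - move=> [E t] /= [TE _]; have [ix jx EE] := repD E (val t) TE.
    by split; [exists (xget 0 E + dig j (val t))|rewrite /= coset_addset // -EE].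
  - move=> [E t] [E' t']; rewrite !inE /= => -[TE _] [TE' _] ff.
    have [_ _ EE] := repD E (val t) TE; have [_ _ EE'] := repD E' (val t') TE'.
    have EE2 : E = E'.
      by rewrite EE EE' -!(coset_addset _ jl) -/(f (E, t)) ff.
    rewrite -EE2 in ff *; congr pair; apply: (dig_inj KL (i := j)).
    by move/coset_eq: ff; rewrite /= opprD addrACA subrr add0r lE.
  - move=> _ [[x ix <-] /=]; rewrite coset_addset // => Tx.
    have /coset_eq/(dig_ex KL N)[t] : coset j x = coset j (xget 0 (coset j x)).
      by have [_ _] := rep _ Tx.
    rewrite -lE => tP; exists (coset j x, t) => //=.
    by apply/coset_eq/(val_ge_sym KL); rewrite opprD addrA.
rewrite (reindex_fsbig f _ _ _ f_bij).
transitivity (\big[*%R/1]_(E \in T) \big[*%R/1]_(t \in [set: N.-tuple k]) h (f (E, t))).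
  rewrite pair_fsbig //; last exact: finite_finset.
  exact: sub_finite_set Tnm (frame_finite (frame_quot ij)).
apply: eq_fsbigr => E; rewrite inE => TE.
(* On the fibre over E the function is constant with value h E, and raising to the power #|k| ^ N,
   the cardinality of the fibre, fixes a root of unity. *)
rewrite (eq_fsbigr (fun=> h E)); last first.
  by move=> t _; have [ix jx EE] := repD E (val t) TE; rewrite /f /= hlj // -EE.
rewrite (fsbigE (index_enum {: N.-tuple k})) ?index_enum_uniq //.
  rewrite (eq_bigl xpredT) ?prodr_const ?card_tuple ?mu_cardX //; first exact: hmu.
  by move=> t; rewrite in_setT.
by move=> t _; rewrite mem_index_enum.
Qed.

Definition chain_transversal (S T : set (set K)) : set (set K) :=
  S `|` (pts K (Q i l) `&` addset K ^~ (P j) @^-1` T).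

(** If x is in P j, the orbit of x + P l is represented in S. Otherwise the image x + P j is
    nonmarked, and freeness of the action makes unique the root of unity z that carries a point of T
    to it; the representative is then z^-1 x + P l. *)
Lemma transversal_chain S T :
  Defs.transversal K n (Q j l) S -> Defs.transversal K n (Q i j) T ->
  Defs.transversal K n (Q i l) (chain_transversal S T).
Proof.
move=> [Snm SE] [Tnm TE]; split.
  move=> E [/Snm/nonmarkedP[x [jx lx ->]]|[[x ix <-] /=]].
    by apply/nonmarkedP; exists x; split=> //; exact: val_ge_le ij jx.
  rewrite coset_addset // => /Tnm/nonmarkedP[y [iy jy xy]].
  apply/nonmarkedP; exists x; split=> // lx; apply: jy.
  move/coset_eq: xy => xy; rewrite -(subKr x y); apply: (val_geB KL) xy.
  exact: val_ge_le jl lx.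
have Tout x : T (coset j x) -> ~ P j x.
  move=> /Tnm/nonmarkedP[y [iy jy /coset_eq xy]] jx; apply: jy.
  by rewrite -(subKr x y); exact: (val_geB KL).
move=> _ /nonmarkedP[x [ix lx ->]]; case: (pselect (P j x)) => jx.
  have [|s [[Ss sx] sU]] := SE (coset l x); first by apply/nonmarkedP; exists x.
  exists s; split; first by split=> //; left.
  move=> s' [[Ss'|[[y iy <-] /= Ty]] xs']; first exact: sU.
  move: Ty; rewrite coset_addset // => /Tout jy; case: xs' => z muz /=.
  rewrite scale_mu_coset // => /coset_eq xy; case: jy.
  have [z0 vz] := mu_val muz; apply/(val_geMl KL _ _ z0); rewrite vz add0r.
  by rewrite -(subKr x (z * y)); apply: (val_geB KL) jx _; exact: val_ge_le xy.
have nmx : nonmarked K (Q i j) (coset j x) by apply/nonmarkedP; exists x.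
have [F [[TF [z muz /= xF]] FU]] := TE _ nmx.
have muV := muV muz; have [z0 vz] := mu_val muz.
have FE : F = coset j (z^-1 * x).
  have /nonmarkedP[y [_ _ FE]] := Tnm _ TF; rewrite FE scale_mu_coset // in xF.
  rewrite FE; apply/coset_eq; apply/(val_geMl KL _ _ z0).
  by rewrite mulrBr mulVKf // vz add0r; apply: (val_ge_sym KL); apply/coset_eq.
exists (coset l (z^-1 * x)); split.
  split; last by exists z; rewrite //= scale_mu_coset // mulVKf.
  right; split; last by rewrite /= coset_addset // -FE.
  exists (z^-1 * x) => //; apply/(val_geMl KL _ _ z0).
  by rewrite mulVKf // vz add0r.
move=> s' [[/Snm/nonmarkedP[y [jy _ ->]]|[[y iy <-] /= Ty]]] [z' muz' /=].
  have [z'0 vz'] := mu_val muz'.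
  rewrite scale_mu_coset // => /coset_eq xy; case: jx.
  rewrite -(subrK (z' * y) x); apply: (val_geD KL); first exact: val_ge_le xy.
  by rewrite -[j]add0r -vz'; apply/(val_geMl KL).
rewrite coset_addset // in Ty; rewrite scale_mu_coset // => xy.
have xyj : coset j x = scale K z' (coset j y).
  by rewrite scale_mu_coset // -!(coset_addset _ jl) xy.
have Fy : F = coset j y by apply: FU; split=> //; exists z'.
have zz' : z = z'.
  by apply: (frame_free n_gt0 (frame_quot ij) muz muz' (Tnm _ TF)) => /=; rewrite -xF xyj Fy.
rewrite -(scale_mu_coset l x muV) xy zz' scale_mu_coset ?mulKf //; last by rewrite -zz'.
by rewrite -zz'.
Qed.

(** Stated for a general h so as to apply both to [ctheta] and to [scale_ratio], whose values at x +
    P l and x + P j agree because they depend only on the leading term of x. *)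
Lemma fsprod_chain S T (h : set K -> K) :
  Defs.transversal K n (Q j l) S -> Defs.transversal K n (Q i j) T ->
  (forall E, nonmarked K (Q i j) E -> mu (h E)) ->
  (forall x, P i x -> ~ P j x -> h (coset l x) = h (coset j x)) ->
  \big[*%R/1]_(E \in chain_transversal S T) h E =
  \big[*%R/1]_(E \in S) h E * \big[*%R/1]_(E \in T) h E.
Proof.
move=> Str Ttr hmu hlj; have [Tnm _] := Ttr; have [Snm _] := Str.
rewrite fsbigU0.
- by rewrite fsprod_fibres // => E /Tnm; exact: hmu.
- exact: sub_finite_set Snm (frame_finite (frame_quot jl)).
- apply: sub_finite_set (finite_quot (le_trans ij jl)); exact: subIsetl.
- move=> E [/Snm/nonmarkedP[x [jx lx ->]] [_ /=]]; rewrite coset_addset //.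
  move=> /Tnm/nonmarkedP[y [iy jy /coset_eq xy]]; apply: jy.
  by rewrite -(subKr x y); exact: (val_geB KL).
Qed.

Lemma det_chain_triv c d : mu c -> mu d ->
  det_chain K n (P i) (P j) (P l) (det_triv (n := n) (X := Q j l) ctheta c)
    (det_triv (n := n) (X := Q i j) ctheta d) =
  det_triv (n := n) (X := Q i l) ctheta (c * d).
Proof.
apply: (det_exact_triv n_gt0 (frame_quot jl) (frame_quot (le_trans ij jl)) (frame_quot ij)).
move=> S T Str Ttr /=; rewrite image_id; split; first exact: transversal_chain.
apply: fsprod_chain => //; first exact: frame_mu (frame_quot ij).
move=> x ix jx; rewrite !ctheta_coset // => lx; apply: jx.
exact: val_ge_le jl lx.
Qed.

End Chain.

End Cosets.

(** * The action of multiplication by f on determinants *)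

Section Scaling.
Context {K : fieldType} {v : K -> int} { pi : K} {k : finFieldType} {red : K -> k}.
Context {n : nat}.
Hypotheses (KL : local_field0 v pi red) (n_gt0 : (0 < n)%N) (n_dvd : (n %| #|k| - 1)%N).
Local Notation P := (val_ge v).
Local Notation O := (val_ring v).
Local Notation mu := (mu K n).
Local Notation tei := (teichmuller (v := v) (red := red)).
Local Notation lead := (lead (v := v) (pi := pi) (red := red)).
Local Notation theta := (theta (v := v) (pi := pi) (red := red) (n := n)).
Local Notation ctheta := (ctheta (v := v) (pi := pi) (red := red) (n := n)).
Local Notation coset := (coset (v := v)).
Local Notation Q i j := (quot K (P i) (P j)).
Local Notation tr i j := (Defs.transversal K n (Q i j)).
Local Notation fr ij := (frame_quot KL n_gt0 n_dvd ij).

Definition chi (f : K) : K := tei (lead f ^+ ((#|k| - 1) %/ n)).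

Lemma chi_mu f : f != 0 -> mu (chi f).
Proof.
move=> f0; apply: (mu_tei KL); rewrite -exprM divnK //.
by rewrite expf_card_pred // (lead_neq0 KL).
Qed.

Lemma chiM f g : f != 0 -> g != 0 -> chi (f * g) = chi f * chi g.
Proof. by move=> f0 g0; rewrite /chi (leadM KL) // exprMn (teiM KL). Qed.

Lemma chi1 : chi 1 = 1.
Proof. by rewrite /chi (lead1 KL) expr1n (tei1 KL). Qed.

Lemma chiV f : f != 0 -> chi f^-1 = (chi f)^-1.
Proof.
move=> f0; have cf0 := mu_neq0 n_gt0 (chi_mu f0).
by apply: (mulfI cf0); rewrite -chiM ?invr_eq0 // !mulfV // chi1.
Qed.

Lemma red_chi f : red (chi f) = lead f ^+ ((#|k| - 1) %/ n).
Proof. exact: red_tei KL _. Qed.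

(** The factor by which f changes the coordinate of a coset. It is constant on mu_n-orbits, so its
    product over a transversal does not depend on the transversal. *)
Definition scale_ratio (f : K) (E : set K) : K := ctheta (scale K f E) / ctheta E.

Lemma val_geN_scale f j x : f != 0 -> ~ P j x -> ~ P (v f + j) (f * x).
Proof. by move=> f0 jx /(val_geMl KL _ _ f0). Qed.

Lemma scale_ratioE f j x : f != 0 -> ~ P j x ->
  scale_ratio f (coset j x) = theta (f * x) / theta x.
Proof.
move=> f0 jx; rewrite /scale_ratio (scale_coset KL) // !(ctheta_coset KL) //.
exact: val_geN_scale.
Qed.

Lemma scale_ratio_mu f i j E : f != 0 -> nonmarked K (Q i j) E -> mu (scale_ratio f E).
Proof.
move=> f0 /(nonmarkedP KL)[x [ix jx ->]]; have [x0 _] := val_geN0 jx.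
rewrite scale_ratioE //; apply: muM (muV _); apply: (theta_mu KL) => //.
by rewrite mulf_neq0.
Qed.

Lemma scale_ratio_act f i j z E : f != 0 -> mu z -> nonmarked K (Q i j) E ->
  scale_ratio f (scale K z E) = scale_ratio f E.
Proof.
move=> f0 muz /(nonmarkedP KL)[x [ix jx ->]]; have [x0 _] := val_geN0 jx.
have [z0 vz] := mu_val KL n_gt0 muz.
rewrite (scale_mu_coset KL n_gt0) // !scale_ratioE //; last first.
  by rewrite -[j]add0r -vz; exact: val_geN_scale.
rewrite (_ : f * (z * x) = z * (f * x)); last by rewrite mulrCA.
rewrite !(thetaM KL n_gt0 n_dvd muz) ?mulf_neq0 // invfM mulrACA mulfV //.
by rewrite mul1r.
Qed.

(** Nonzero classes of P j / P (j + 1) are determined by their leading coefficients, so the product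
    is the lift to K of the one in [prod_angle]. *)
Lemma fsprod_scale_ratio_step f j S : f != 0 -> tr j (j + 1) S ->
  \big[*%R/1]_(E \in S) scale_ratio f E = chi f.
Proof.
move=> f0 Str; have jj : j <= j + 1 by lia.
rewrite (fsprod_transversal n_gt0 (fr jj) _ Str (transversal_frame n_gt0 (fr jj))); last first.
  by move=> z E muz; exact: scale_ratio_act.
set S0 := [set E | _].
(* The product is now over S0, the cosets where [ctheta] is 1; h identifies them with the
   representatives of the orbits in k^*. *)
pose h (u : k) := coset (j + 1) (tei u * pi ^ j).
have hP u : u != 0 -> [/\ P j (tei u * pi ^ j), ~ P (j + 1) (tei u * pi ^ j),
    tei u * pi ^ j != 0 & lead (tei u * pi ^ j) = u].
  move=> u0; have [x0 vx lx] := lead_tei KL j u0; split=> //.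
    by right; rewrite vx.
  by move=> /(val_geE _ x0); rewrite vx; lia.
have h_bij : set_bij [set` orbit_reps k (n := n)] S0 h.
  split.
  - move=> u /= /orbit_repsP[u0 uE]; have [jx jx1 x0 lx] := hP u u0.
    split; first by apply/(nonmarkedP KL); exists (tei u * pi ^ j).
    rewrite /h (ctheta_coset KL) // /theta lx /angle uE divff //; exact: tei1 KL.
  - by move=> u w _ _ /(coset_eq KL) e; exact: (digit_inj KL e).
  - move=> _ [/(nonmarkedP KL)[x [jx jx1 ->]]]; rewrite (ctheta_coset KL) // => tx.
    have [x0 vx] := val_geN0 jx1; have vxj : v x = j.
      by move: jx => /(val_geE _ x0); lia.
    exists (lead x).
      rewrite /= inE (lead_neq0 KL) //=; apply/eqP; apply: (tei_inj KL).
      by rewrite (tei1 KL).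
    apply/(coset_eq KL)/(val_ge_sym KL).
    by have := digit_ex KL jx; rewrite /lead vxj.
rewrite (reindex_fsbig h _ _ _ h_bij).
rewrite -(bigfs _ (r := index_enum k)) ?index_enum_uniq //; last first.
  by move=> u _; rewrite mem_index_enum.
rewrite (eq_bigr (fun u => tei (angle (n := n) (lead f * u)))); last first.
  move=> u /orbit_repsP[u0 uE]; have [jx jx1 x0 lx] := hP u u0.
  rewrite /h scale_ratioE // /theta (leadM KL) // lx.
  by rewrite [angle u]/angle uE divff // (tei1 KL) divr1.
rewrite -(big_morph _ (teiM KL) (tei1 KL)); congr tei.
by apply: (prod_angle n_gt0 n_dvd); exact: lead_neq0 KL _ f0.
Qed.

(** Induction along the filtration: the graded piece P (i + N) / P (i + N + 1) contributes one
    factor chi f, and P i / P (i + N) the others. *)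
Lemma fsprod_scale_ratio f i N S : f != 0 -> tr i (i + N%:Z) S ->
  \big[*%R/1]_(E \in S) scale_ratio f E = chi f ^+ N.
Proof.
move=> f0; elim: N S => [|N IH] S.
  rewrite addr0 => -[Snm _]; rewrite (_ : S = set0) ?fsbig_set0 //.
  by rewrite -subset0 => E /Snm/(nonmarkedP KL)[x [ix /(_ ix)]].
have ij : i <= i + N%:Z by lia.
have jl : i + N%:Z <= i + N.+1%:Z by lia.
have jE : i + N.+1%:Z = i + N%:Z + 1 by lia.
move=> Str; have T1 := transversal_frame n_gt0 (fr jl).
have T2 := transversal_frame n_gt0 (fr ij).
rewrite (fsprod_transversal n_gt0 (fr (le_trans ij jl)) _ Str
  (transversal_chain KL n_gt0 n_dvd ij jl T1 T2)); last first.
  by move=> z E muz; exact: scale_ratio_act.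
rewrite (fsprod_chain KL n_gt0 n_dvd ij jl T1 T2).
- rewrite exprS (IH _ T2); congr (_ * _).
  by apply: (fsprod_scale_ratio_step (j := i + N%:Z)) => //; rewrite -jE.
- by move=> E; exact: scale_ratio_mu.
- move=> x ix jx; rewrite !scale_ratioE // => lx; apply: jx.
  exact: val_ge_le jl lx.
Qed.

Lemma transversal_scale f i j S : f != 0 -> tr i j S ->
  tr (v f + i) (v f + j) (scale K f @` S).
Proof.
move=> f0 [Snm SE]; split=> [_ [E /Snm/(nonmarkedP KL)[x [ix jx ->]] <-]|].
  apply/(nonmarkedP KL); exists (f * x); rewrite (scale_coset KL) //; split=> //.
    by apply/(val_geMl KL).
  exact: val_geN_scale.
have scaleK E : scale K f^-1 (scale K f E) = E.
  apply/seteqP; split=> [_ [_ [x Ex <-] <-]|x Ex]; first by rewrite mulKf.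
  by exists (f * x); [exists x|rewrite mulKf].
have scaleC z E : scale K z (scale K f E) = scale K f (scale K z E).
  apply/seteqP; split=> [_ [_ [x Ex <-] <-]|_ [_ [x Ex <-] <-]].
    by rewrite mulrCA; exists (z * x) => //; exists x.
  by rewrite mulrCA; exists (f * x) => //; exists x.
move=> _ /(nonmarkedP KL)[y [iy jy ->]].
have yE : y = f * (f^-1 * y) by rewrite mulVKf.
rewrite yE in iy jy *; move: iy => /(val_geMl KL _ _ f0); set x := f^-1 * y => ix.
have jx : ~ P j x by move=> jx; apply: jy; apply/(val_geMl KL).
have [|s [[Ss [z muz /= xs]] sU]] := SE (coset j x).
  by apply/(nonmarkedP KL); exists x.
rewrite -(scale_coset KL) //; exists (scale K f s); split.
  by split; [exists s|exists z; rewrite //= xs scaleC].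
move=> _ [[s' Ss' <-] [w muw /= e]]; congr (scale K f _); apply: sU; split=> //.
by exists w; rewrite //= -[RHS]scaleK -scaleC -e scaleK.
Qed.

(** The exponent j - i is the length of P i / P j; each coset of a transversal contributes its
    [scale_ratio] to the product of [ctheta] over the scaled transversal. *)
Lemma det_map_scale f i j i' j' c : f != 0 -> i <= j -> i' = v f + i -> j' = v f + j ->
  mu c ->
  det_map K n (Q i j) (Q i' j') (scale K f) (det_triv (n := n) (X := Q i j) ctheta c) =
  det_triv (n := n) (X := Q i' j') ctheta (chi f ^ (j - i) * c).
Proof.
move=> f0 ij -> ->; have ij' : v f + i <= v f + j by lia.
apply: (det_map_triv n_gt0 (fr ij) (fr ij')) => S Str.
split; first exact: transversal_scale.
have [Snm _] := Str.
have scale_inj : set_inj S (scale K f).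
  move=> E F _ _ EF; apply/seteqP; split=> x Ex.
    have : scale K f E (f * x) by exists x.
    by rewrite EF => -[y Fy /(mulfI f0) <-].
  have : scale K f F (f * x) by exists x.
  by rewrite -EF => -[y Fy /(mulfI f0) <-].
rewrite fsbig_image // (_ : chi f ^ _ = \big[*%R/1]_(E \in S) scale_ratio f E); last first.
  have jE : j = i + (absz (j - i))%:Z by lia.
  by rewrite jE in Str; rewrite (fsprod_scale_ratio f0 Str) {1}jE addrAC subrr add0r.
rewrite -fsbig_split; last exact: sub_finite_set Snm (frame_finite (fr ij)).
apply: eq_fsbigr => E; rewrite inE => SE; rewrite /= /scale_ratio divfK //.
by apply: (mu_neq0 n_gt0); apply: frame_mu (fr ij) _ (Snm _ SE).
Qed.

End Scaling.

(** * Relative determinants and the extension *)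

Section RelativeDeterminants.
Context {K : fieldType} {v : K -> int} { pi : K} {k : finFieldType} {red : K -> k}.
Context {n : nat}.
Hypotheses (KL : local_field0 v pi red) (n_gt0 : (0 < n)%N) (n_dvd : (n %| #|k| - 1)%N).
Local Notation P := (val_ge v).
Local Notation O := (val_ring v).
Local Notation mu := (mu K n).
Local Notation ctheta := (ctheta (v := v) (pi := pi) (red := red) (n := n)).
Local Notation chi := (chi (v := v) (pi := pi) (red := red) (n := n)).
Local Notation Q i j := (quot K (P i) (P j)).
Local Notation fr ij := (frame_quot KL n_gt0 n_dvd ij).

Definition det_pt (i j : int) : K -> set (K * set (set K)) :=
  det_triv (n := n) (X := Q i j) ctheta.

Definition dual_pt (i j : int) : K -> (set (K * set (set K)) -> K) :=
  dual_triv (n := n) (det_pt i j).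

(** The point of (P i | P j) with coordinate c; the maximum is there because P i and P j meet in P
    (max i j). *)
Definition rel_pt (i j : int) : K -> relT K n O :=
  pair_fiber (n := n) (det_pt i (Num.max i j)) (dual_pt j (Num.max i j)).

Lemma det_ptP i j : i <= j -> trivialisation (n := n) (L := det K n (Q i j)) (det_pt i j).
Proof. by move=> ij; exact: (triv_det n_gt0 (fr ij)). Qed.

Lemma dual_ptP i j : i <= j ->
  trivialisation (n := n) (L := dual K n (det K n (Q i j))) (dual_pt i j).
Proof. by move=> ij; exact: (triv_dual (det_ptP ij)). Qed.

Lemma val_geI i j : P i `&` P j = P (Num.max i j).
Proof.
apply/seteqP; split=> x [].
- by move=> [x0|ix] [x0'|jx]; [left|left|left|right; rewrite ge_max ix].
- by move=> ->; split; left.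
- by rewrite ge_max => /andP[ix jx]; split; right.
Qed.

Lemma rel_ptP i j : trivialisation (n := n) (L := Defs.rel K n (P i) (P j)) (rel_pt i j).
Proof.
rewrite /Defs.rel val_geI; apply: (triv_tensor n_gt0); first by apply: det_ptP; rewrite le_max lexx.
by apply: dual_ptP; rewrite le_max lexx orbT.
Qed.

Lemma rel_pt_down i j : i <= j ->
  rel_pt i j = pair_fiber (n := n) (det_pt i j) (dual_pt j j).
Proof. by move=> ij; rewrite /rel_pt max_r. Qed.

Lemma rel_pt_up i j : j <= i ->
  rel_pt i j = pair_fiber (n := n) (det_pt i i) (dual_pt j i).
Proof. by move=> ji; rewrite /rel_pt max_l. Qed.

Lemma det_scalar_pt i c : mu c -> Defs.det_scalar K n (P i) c = det_pt i i c.
Proof.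
move=> muc; have str : Defs.transversal K n (Q i i) set0.
  by split=> // E /(nonmarkedP KL)[x [ix /(_ ix)]].
rewrite /Defs.det_scalar (det_classE n_gt0 (fr (lexx i)) muc str).
by rewrite fsbig_set0 mulr1.
Qed.

Lemma dual_one_pt i : dual_one K n (P i) = dual_pt i i 1.
Proof.
apply/funext => d; rewrite /dual_one /dual_pt /dual_triv mul1r; congr xget.
by apply/seteqP; split=> z [muz ->]; split=> //; rewrite det_scalar_pt.
Qed.

Lemma of_det_pt i j c : i <= j -> mu c ->
  of_det K n (P i) (P j) (det_pt i j c) = rel_pt i j c.
Proof.
move=> ij muc; rewrite /of_det dual_one_pt rel_pt_down //.
rewrite (tens_triv n_gt0 (det_ptP ij) (dual_ptP (lexx j)) muc mu1).
by rewrite mulr1.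
Qed.

Lemma of_dual_pt i j c : j <= i -> mu c ->
  of_dual K n (P i) (P j) (dual_pt j i c) = rel_pt i j c.
Proof.
move=> ji muc; rewrite /of_dual (det_scalar_pt i mu1) rel_pt_up //.
rewrite (tens_triv n_gt0 (det_ptP (lexx i)) (dual_ptP ji) mu1 muc).
by rewrite mul1r.
Qed.

Lemma to_det_pt i j c : i <= j -> mu c ->
  to_det K n (P i) (P j) (rel_pt i j c) = det_pt i j c.
Proof.
move=> ij muc; apply: xget_unique.
  by split; [apply: (triv_mem (det_ptP ij))|rewrite of_det_pt].
move=> _ [/(triv_pts (det_ptP ij))[d mud ->]]; rewrite of_det_pt // => cd.
by rewrite (triv_inj (rel_ptP i j) muc mud cd).
Qed.

Lemma to_dual_pt i j c : j <= i -> mu c ->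
  to_dual K n (P i) (P j) (rel_pt i j c) = dual_pt j i c.
Proof.
move=> ji muc; apply: xget_unique.
  by split; [apply: (triv_mem (dual_ptP ji))|rewrite of_dual_pt].
move=> _ [/(triv_pts (dual_ptP ji))[d mud ->]]; rewrite of_dual_pt // => cd.
by rewrite (triv_inj (rel_ptP i j) muc mud cd).
Qed.

Lemma dual_ptE i j c d : i <= j -> mu d -> dual_pt i j c (det_pt i j d) = c * d.
Proof. by move=> ij mud; exact: (dual_trivE (det_ptP ij) c mud). Qed.

Lemma kappa_pair_pt i j c d : mu c -> mu d ->
  kappa_pair K n (P i) (P j) (rel_pt i j c) (rel_pt j i d) = c * d.
Proof.
move=> muc mud; have im : i <= Num.max i j by rewrite le_max lexx.
have jm : j <= Num.max i j by rewrite le_max lexx orbT.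
apply: xget_unique.
  (* One choice of representatives, with both coordinates carried by the determinant factors; any
     other choice gives the same product. *)
  exists (det_pt i (Num.max i j) c), (dual_pt j (Num.max i j) 1).
  exists (det_pt j (Num.max i j) d), (dual_pt i (Num.max i j) 1).
  split; last by rewrite !dual_ptE // !mul1r mulrC.
    by exists c, 1; split; rewrite ?mulr1 //; exact: mu1.
  by exists d, 1; rewrite maxC; split; rewrite ?mulr1 //; exact: mu1.
move=> _ [a [phi [b [psi [[c1 [c2 [muc1 muc2 [-> ->] <-]]] + ->]]]]].
rewrite /rel_pt (maxC j i) => -[d1 [d2 [mud1 mud2 [-> ->] <-]]].
by rewrite !dual_ptE //; ring.
Qed.

Lemma kappa_down_pt i j l c d : i <= j -> j <= l -> mu c -> mu d ->
  kappa_down K n (P i) (P j) (P l) (rel_pt i j c) (rel_pt j l d) = rel_pt i l (c * d).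
Proof.
move=> ij jl muc mud; rewrite /kappa_down !to_det_pt //.
rewrite (det_chain_triv KL n_gt0 n_dvd ij jl mud muc).
by rewrite -/(det_pt i l _) mulrC of_det_pt ?(le_trans ij) //; exact: muM.
Qed.

Lemma kappa_up_pt i j l c d : j <= i -> l <= j -> mu c -> mu d ->
  kappa_up K n (P i) (P j) (P l) (rel_pt i j c) (rel_pt j l d) = rel_pt i l (c * d).
Proof.
move=> ji lj muc mud; have li := le_trans lj ji; rewrite /kappa_up !to_dual_pt //.
rewrite -of_dual_pt //; last exact: muM.
congr of_dual; apply/funext => w.
case: (pselect (pts K (det K n (Q l i)) w)) => [/(triv_pts (det_ptP li))[e mue ->]|lw].
  rewrite dual_ptE //; apply: xget_unique.
    exists (det_pt j i e), (det_pt l j 1); split.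
    - exact: (triv_mem (det_ptP ji)).
    - by apply: (triv_mem (det_ptP lj)); exact: mu1.
    - by rewrite (det_chain_triv KL n_gt0 n_dvd lj ji mue mu1) mulr1.
    - by rewrite !dual_ptE ?mulr1 //; [rewrite mulrAC|exact: mu1].
  move=> z [x [y [/(triv_pts (det_ptP ji))[b mub ->] /(triv_pts (det_ptP lj))[b' mub' ->]]]].
  rewrite (det_chain_triv KL n_gt0 n_dvd lj ji mub mub').
  move=> /(triv_inj (det_ptP li) mue (muM mub mub')) -> ->.
  by rewrite !dual_ptE // mulrACA.
(* Off the line both sides are 0: no b and c exist, so [xget] returns its default, and [dual_triv]
   vanishes there. *)
rewrite xgetPN /dual_pt; first by rewrite (dual_triv0 (det_ptP li)).
move=> z [x [y [/(triv_pts (det_ptP ji))[b mub ->] /(triv_pts (det_ptP lj))[b' mub' ->]]]].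
rewrite (det_chain_triv KL n_gt0 n_dvd lj ji mub mub') => wE _.
by apply: lw; rewrite wE; apply: (triv_mem (det_ptP li)); exact: muM.
Qed.

Definition tensor_pt (i l j : int) : K -> set (relT K n O * relT K n O) :=
  pair_fiber (n := n) (rel_pt i l) (rel_pt l j).

Lemma tens_pt i l j c d : mu c -> mu d ->
  tens K n (Defs.rel K n (P i) (P l)) (Defs.rel K n (P l) (P j)) (rel_pt i l c) (rel_pt l j d) =
  tensor_pt i l j (c * d).
Proof. by move=> muc mud; exact: (tens_triv n_gt0 (rel_ptP i l) (rel_ptP l j) muc mud). Qed.

Lemma tensor_pt_inj i l j c d : mu c -> mu d -> tensor_pt i l j c = tensor_pt i l j d -> c = d.
Proof. by move=> muc mud; exact: (pair_fiber_inj (rel_ptP i l) (rel_ptP l j) muc mud). Qed.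

Lemma kappa_split_pt l i j c : i <= l -> j <= l -> mu c ->
  kappa_split K n (P l) (P i) (P j) (rel_pt i j c) = tensor_pt i l j c.
Proof.
move=> il jl muc; rewrite /kappa_split val_geI; set m := Num.max i j.
have im : i <= m by rewrite le_max lexx.
have jm : j <= m by rewrite le_max lexx orbT.
have ml : m <= l by rewrite ge_max il.
(* The auxiliary points u and u' have coordinates x and y with x * y = 1, so they cancel and only c1
   * c2 = c remains. *)
have step c1 c2 x y : mu c1 -> mu c2 -> mu x -> mu y -> x * y = 1 -> c1 * c2 = c ->
    tens K n (Defs.rel K n (P i) (P l)) (Defs.rel K n (P l) (P j))
      (kappa_down K n (P i) (P m) (P l) (of_det K n (P i) (P m) (det_pt i m c1)) (rel_pt m l x))
      (kappa_up K n (P l) (P m) (P j) (rel_pt l m y) (of_dual K n (P m) (P j) (dual_pt j m c2)))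
    = tensor_pt i l j c.
  move=> muc1 muc2 mux muy xy <-; rewrite of_det_pt // of_dual_pt //.
  rewrite kappa_down_pt // kappa_up_pt // tens_pt; try exact: muM.
  by rewrite [y * c2]mulrC mulrACA xy mulr1.
apply/seteqP; split=> p /=.
  move=> [a [phi [u [u' [[c1 [c2 [muc1 muc2 [-> ->] c12]]]]]]]].
  move=> /(triv_pts (rel_ptP m l))[x mux ->] /(triv_pts (rel_ptP l m))[y muy ->].
  by rewrite kappa_pair_pt // => xy; rewrite step.
move=> cp; exists (det_pt i m c), (dual_pt j m 1), (rel_pt m l 1), (rel_pt l m 1).
have mu1 := @mu1 K n; split.
- by exists c, 1; rewrite mulr1.
- exact: (triv_mem (rel_ptP m l)).
- exact: (triv_mem (rel_ptP l m)).
- by rewrite kappa_pair_pt ?mulr1.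
- by rewrite step ?mulr1.
Qed.

Lemma kappa_contract_pt l i j m c d : mu c -> mu d ->
  kappa_contract K n (P l) (P i) (P j) (P m) (tensor_pt i l j c) (tensor_pt j l m d) =
  tensor_pt i l m (c * d).
Proof.
move=> muc mud; rewrite /kappa_contract.
have step x y : tensor_pt i l j c x -> tensor_pt j l m d y ->
    tens K n (Defs.rel K n (P i) (P l)) (Defs.rel K n (P l) (P m))
      (act K (Defs.rel K n (P i) (P l)) (kappa_pair K n (P l) (P j) x.2 y.1) x.1) y.2 =
    tensor_pt i l m (c * d).
  move=> [c1 [c2 [muc1 muc2 -> <-]]] [d1 [d2 [mud1 mud2 -> <-]]].
  have mucd := muM muc2 mud1.
  rewrite (_ : kappa_pair _ _ _ _ _ _ = c2 * d1); last exact: kappa_pair_pt.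
  rewrite (_ : act _ _ _ _ = rel_pt i l (c2 * d1 * c1)); last first.
    exact: (triv_act (rel_ptP i l) mucd muc1).
  rewrite tens_pt //; last exact: muM.
  by rewrite [c2 * d1 * c1]mulrC !mulrA.
apply/seteqP; split=> [p [x cx] [y dy]|p cdp]; first by rewrite step.
have mu1 := @mu1 K n.
have cx : tensor_pt i l j c (rel_pt i l c, rel_pt l j 1) by exists c, 1; rewrite mulr1.
have dy : tensor_pt j l m d (rel_pt j l d, rel_pt l m 1) by exists d, 1; rewrite mulr1.
by exists (rel_pt i l c, rel_pt l j 1) => //; exists (rel_pt j l d, rel_pt l m 1); rewrite ?step.
Qed.

(** Splitting preserves coordinates and contraction multiplies them, so the equation defining w
    forces its coordinate to be c * d, by [tensor_pt_inj]. *)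
Lemma kappa_pt i j m c d : mu c -> mu d ->
  kappa K n (P i) (P j) (P m) (rel_pt i j c) (rel_pt j m d) = rel_pt i m (c * d).
Proof.
move=> muc mud; rewrite /kappa !val_geI.
set l := Num.max (Num.max i j) m.
have [il jl ml] : [/\ i <= l, j <= l & m <= l] by split; rewrite !le_max lexx ?orbT.
have mucd := muM muc mud; rewrite !kappa_split_pt // kappa_contract_pt //.
apply: xget_unique.
  by split; [exact: (triv_mem (rel_ptP i m))|rewrite kappa_split_pt].
move=> _ [/(triv_pts (rel_ptP i m))[e mue ->]]; rewrite kappa_split_pt //.
by move=> /(tensor_pt_inj mue mucd) ->.
Qed.

Lemma chiXz_mu f (z : int) : f != 0 -> mu (chi f ^ z).
Proof.
move=> /(chi_mu KL n_dvd) muf; have aux m : mu (chi f ^+ m).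
  by rewrite /Defs.mu /= exprAC muf expr1n.
by case: z => m; [exact: aux|rewrite NegzE -exprnN; exact: muV].
Qed.

(** With m = max i j, the determinant of P i / P m contributes chi f ^ (m - i) and the dual of the
    map induced by f^-1 contributes chi f ^ (j - m); m drops out of the total exponent. *)
Lemma rho_pt f i j c : f != 0 -> mu c ->
  rho K n f (P i) (P j) (rel_pt i j c) = rel_pt (v f + i) (v f + j) (chi f ^ (j - i) * c).
Proof.
move=> f0 muc; rewrite /rho !(scale_val_ge KL) // !val_geI.
set m := Num.max i j; set m' := Num.max (v f + i) (v f + j).
have mE : m' = v f + m by rewrite /m' -addr_maxr.
have im : i <= m by rewrite le_max lexx.
have jm : j <= m by rewrite le_max lexx orbT.
have im' : v f + i <= m' by rewrite le_max lexx.
have jm' : v f + j <= m' by rewrite le_max lexx orbT.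
have fV0 : f^-1 != 0 by rewrite invr_eq0.
have mu1 := chiXz_mu (m - i) f0; have mu2 := chiXz_mu (m - j) fV0.
have chi0 := mu_neq0 n_gt0 (chi_mu KL n_dvd f0).
rewrite (tensor_map_triv n_gt0 (s := chi f ^ (m - i)) (t := chi f^-1 ^ (m - j))
  (det_ptP im) (dual_ptP jm) (det_ptP im') (dual_ptP jm')) //.
- rewrite -/m' /rel_pt -/m' (chiV KL n_gt0 n_dvd) // exprz_inv -expfzDr //.
  by congr (pair_fiber _ _ (_ ^ _ * _)); lia.
- by move=> d mud; exact: (det_map_scale KL n_gt0 n_dvd f0 im erefl mE mud).
- move=> d mud; apply: (dual_map_triv (det_ptP jm') (det_ptP jm)) => // e mue.
  have vE : v f^-1 = - v f by exact: val_inv KL _ f0.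
  have jE : j = v f^-1 + (v f + j) by rewrite vE addKr.
  have mE' : m = v f^-1 + m' by rewrite vE mE addKr.
  have -> : chi f^-1 ^ (m - j) = chi f^-1 ^ (m' - (v f + j)).
    by congr (_ ^ _); rewrite mE; lia.
  exact: (det_map_scale KL n_gt0 n_dvd fV0 jm' jE mE' mue).
Qed.

End RelativeDeterminants.

(** * The central extension in coordinates *)

Section Extension.
Context {K : fieldType} {v : K -> int} { pi : K} {k : finFieldType} {red : K -> k}.
Context {n : nat}.
Hypotheses (KL : local_field0 v pi red) (n_gt0 : (0 < n)%N) (n_dvd : (n %| #|k| - 1)%N).
Local Notation O := (val_ring v).
Local Notation mu := (mu K n).
Local Notation chi := (chi (v := v) (pi := pi) (red := red) (n := n)).
Local Notation rel_pt := (rel_pt (v := v) (pi := pi) (red := red) (n := n)).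

(** The point over f with coordinate c: its second component lies in (O | f O), and f O = P (v
    f). *)
Definition ext_pt (f c : K) : K * relT K n O := (f, rel_pt 0 (v f) c).

Lemma scale_val_ring f : f != 0 -> scale K f O = val_ge v (v f).
Proof. by move=> f0; rewrite (scale_val_ge KL) // addr0. Qed.

Lemma ext_ptP x : ext K n O x <-> x.1 != 0 /\ exists2 c, mu c & x = ext_pt x.1 c.
Proof.
case: x => f s /=; split=> [[/= f0]|[f0 [c muc [->]]]].
  rewrite scale_val_ring // => /(triv_pts (rel_ptP KL n_gt0 n_dvd 0 (v f)))[c muc ->].
  by split=> //; exists c.
split=> //=; rewrite scale_val_ring //.
exact: (triv_mem (rel_ptP KL n_gt0 n_dvd 0 (v f))).
Qed.

Lemma ext_pt_inj f c d : mu c -> mu d -> ext_pt f c = ext_pt f d -> c = d.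
Proof.
by move=> muc mud [/(triv_inj (rel_ptP KL n_gt0 n_dvd 0 (v f)) muc mud)].
Qed.

(** The twist chi f ^ v g is the scalar by which [rho] carries (O | g O) to (f O | f g O). *)
Lemma ext_mul_pt f g c d : f != 0 -> g != 0 -> mu c -> mu d ->
  ext_mul K n O (ext_pt f c) (ext_pt g d) = ext_pt (f * g) (c * d * chi f ^ v g).
Proof.
move=> f0 g0 muc mud; rewrite /ext_mul /= !scale_val_ring ?mulf_neq0 //.
rewrite (rho_pt KL n_gt0 n_dvd 0 (v g) f0 mud) addr0 subr0 (val_mul KL) //.
rewrite (kappa_pt KL n_gt0 n_dvd 0 (v f) (v f + v g) muc); last first.
  by apply: muM _ mud; exact: (chiXz_mu KL n_dvd _ f0).
by rewrite /ext_pt (val_mul KL) //; congr (_, rel_pt _ _ _); rewrite [RHS]mulrAC mulrA.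
Qed.

Lemma ext_mu_pt z : mu z -> ext_mu K n O z = ext_pt 1 z.
Proof.
move=> muz; rewrite /ext_mu /ext_pt (val_one KL); congr pair.
rewrite (det_scalar_pt KL n_gt0 n_dvd 0 muz).
exact: (of_det_pt KL n_gt0 n_dvd (lexx 0) muz).
Qed.

(** The factor chi f ^ v f compensates the twist chi f ^ (- v f) in the product of a point over f
    with a point over f^-1. *)
Lemma ext_inv_pt f c : f != 0 -> mu c ->
  ext_inv K n O (ext_pt f c) = ext_pt f^-1 (c^-1 * chi f ^ v f).
Proof.
move=> f0 muc; have fV0 : f^-1 != 0 by rewrite invr_eq0.
have muX z := chiXz_mu KL n_dvd z f0.
have muc' : mu (c^-1 * chi f ^ v f) by apply: muM (muV muc) (muX _).
have c0 := mu_neq0 n_gt0 muc; have chi0 := mu_neq0 n_gt0 (chi_mu KL n_dvd f0).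
rewrite /ext_inv /ext_one (ext_mu_pt mu1); apply: xget_unique.
  split.
  - by apply/ext_ptP; split=> //=; exists (c^-1 * chi f ^ v f).
  - rewrite ext_mul_pt // mulfV // (val_inv KL) // mulrA mulfV // mul1r.
    by rewrite -expfzDr // addrN expr0z.
  - rewrite ext_mul_pt // mulVf // (chiV KL n_gt0 n_dvd) // exprz_inv.
    by rewrite [c^-1 * _]mulrC divfK // -expfzDr // addrN expr0z.
move=> y [/ext_ptP[]]; move: y.1 => g g0 [d mud ->].
rewrite ext_mul_pt // => e _; have fg : f * g = 1 := congr1 fst e.
rewrite fg in e; have {}e := ext_pt_inj (muM (muM muc mud) (muX _)) mu1 e.
have gE : g = f^-1 by apply: (mulfI f0); rewrite fg mulfV.
rewrite gE; congr ext_pt; apply: (mulfI c0); rewrite mulVKf //.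
apply: (mulIf (mu_neq0 n_gt0 (muX (v g)))).
by rewrite e gE (val_inv KL) // -expfzDr // addrN expr0z.
Qed.

(** The coordinates c, d and the twists chi a ^ v a, chi b ^ v b all cancel; only the two mixed
    twists survive. *)
Lemma ext_comm_pt a b c d : a != 0 -> b != 0 -> mu c -> mu d ->
  ext_comm K n O (ext_pt a c) (ext_pt b d) =
  ext_pt 1 (chi a ^ v b / chi b ^ v a).
Proof.
move=> a0 b0 muc mud; have [aV0 bV0] : a^-1 != 0 /\ b^-1 != 0 by rewrite !invr_eq0.
have ab0 : a * b != 0 by rewrite mulf_neq0.
have aba0 : a * b / a != 0 by rewrite mulf_neq0.
have muX f z (f0 : f != 0) : mu (chi f ^ z) := chiXz_mu KL n_dvd z f0.
have [c0 d0] := (mu_neq0 n_gt0 muc, mu_neq0 n_gt0 mud).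
have chia0 := mu_neq0 n_gt0 (chi_mu KL n_dvd a0).
have chib0 := mu_neq0 n_gt0 (chi_mu KL n_dvd b0).
rewrite /ext_comm !ext_inv_pt // ext_mul_pt //.
have mu1 := muM (muM muc mud) (muX a (v b) a0).
have mu2 := muM (muV muc) (muX a (v a) a0).
have mu3 := muM (muV mud) (muX b (v b) b0).
rewrite ext_mul_pt // ext_mul_pt //; last by apply: muM (muM mu1 mu2) (muX _ _ _).
have abE : a * b / a = b by rewrite mulrAC mulfV // mul1r.
rewrite abE mulfV // !(val_inv KL) // (chiM KL) // expfzMl -!invr_expz.
congr ext_pt.
have chiX0 f z : chi f != 0 -> chi f ^ z != 0 by exact: expfz_neq0.
by field; rewrite c0 d0 !chiX0.
Qed.

End Extension.

Theorem mainTheorem1 (K : fieldType) (v : K -> int) (pi : K)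
    (k : finFieldType) (red : K -> k) (q n : nat)
    (K_local : local_field0 v pi red)
    (q_card : #|k| = q)
    (n_gt0 : (0 < n)%N) (n_dvd : (n %| q - 1)%N)
    (a b : K) (a_neq0 : a != 0) (b_neq0 : b != 0)
    (ta tb : K * relT K n (val_ring v))
    (ta_ext : ext K n (val_ring v) ta) (ta_lift : ta.1 = a)
    (tb_ext : ext K n (val_ring v) tb) (tb_lift : tb.1 = b) :
  exists zeta : K,
    [/\ mu K n zeta,
        ext_comm K n (val_ring v) ta tb = ext_mu K n (val_ring v) zeta &
        red zeta = red (a ^ v b / b ^ v a) ^+ ((q - 1) %/ n)].
Proof.
rewrite -q_card in n_dvd *.
have /(ext_ptP K_local n_gt0 n_dvd)[_ [c muc ->]] := ta_ext.
have /(ext_ptP K_local n_gt0 n_dvd)[_ [d mud ->]] := tb_ext.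
rewrite ta_lift tb_lift (ext_comm_pt K_local n_gt0 n_dvd) //.
pose ch := chi (v := v) (pi := pi) (red := red) (n := n).
have mua : mu K n (ch a ^ v b) by exact: chiXz_mu.
have mub : mu K n (ch b ^ v a) by exact: chiXz_mu.
have muz := muM mua (muV mub).
exists (ch a ^ v b / ch b ^ v a); split=> //; first by rewrite (ext_mu_pt K_local).
have [chia0 chib0] : ch a != 0 /\ ch b != 0.
  by split; apply: (mu_neq0 n_gt0); exact: chi_mu.
(* Both arguments of [red] have valuation 0, so [red] can be replaced there by the leading
   coefficient, which is computed factor by factor even when a or b lies outside O. *)
pose ld := lead (v := v) (pi := pi) (red := red).
have redE x : v x = 0 -> red x = ld x by move=> vx; rewrite /ld lead_red.
have ld_ch f : f != 0 -> ld (ch f) = ld f ^+ ((#|k| - 1) %/ n).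
  move=> f0; rewrite -redE ?(red_chi K_local) //.
  by have [] := mu_val K_local n_gt0 (chi_mu K_local n_dvd f0).
have ld_quot x y (z w : int) : x != 0 -> y != 0 -> ld (x ^ z / y ^ w) = ld x ^ z / ld y ^ w.
  move=> x0 y0; rewrite /ld (leadM K_local) ?invr_eq0 ?expfz_neq0 //.
  by rewrite (leadV K_local) ?expfz_neq0 // !(leadXz K_local).
rewrite !redE; first last.
- by have [] := mu_val K_local n_gt0 muz.
(* The valuation of a ^ v b / b ^ v a is v a * v b - v b * v a = 0. *)
- rewrite (val_mul K_local) ?invr_eq0 ?expfz_neq0 // (val_inv K_local) ?expfz_neq0 //.
  by rewrite !(val_expz K_local) // mulrC subrr.
rewrite !ld_quot // !ld_ch // exprMn exprVn.
(* It remains to exchange the integer exponents v b and v a with (#|k| - 1) %/ n. *)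
by congr (_ / _); exact: (exprzAC _ (Posz _)).
Qed.
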